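(* Let $X$ be a centered infinitely divisible random vector in $\mathbb{R}^d$ with finite second moment. Suppose that $V_X(u)$ and the law of $R_u$ are known for every unit vector $u$ with $V_X(u)>0$, and that the directions with zero variance are identified. Then the law of $X$, and hence its Lévy triplet, is determined. That is: if $X$ and $X'$ are two centered infinitely divisible random vectors in $\mathbb{R}^d$ with finite second moments such that $V_X(u)=V_{X'}(u)$ for every unit vector $u$, and the directional remainders of $X$ and $X'$ in direction $u$ have the same law for every unit vector $u$ with $V_X(u)>0$, then $X$ and $X'$ have the same law, and hence the same Lévy triplet.
   Context: $X$ is a centered infinitely divisible random vector in $\mathbb{R}^d$ with finite second moment; $A$ is the covariance matrix of its Gaussian component and $\nu$ its Lévy measure. The covariance matrix is $\Sigma=A+\int xx^\top\,\nu(dx)$ and $V_X(t):=t^\top\Sigma t$. Directional remainder: for $t$ with $V_X(t)>0$, let $H_t$ be the finite measure on $\mathbb{R}$ given by $$H_t(S)=(t^\top A t)\mathbf 1_{\{0\in S\}}+\int_{\mathbb{R}^d}\mathbf 1_{\{\langle t,x\rangle\in S\}}\langle t,x\rangle^2\,\nu(dx),$$ which has total mass $V_X(t)$. Let $Y_t$ have distribution $H_t/V_X(t)$, let $B$ be independent of $Y_t$ with density $2(1-b)\mathbf 1_{(0,1)}(b)$, and set $R_t=BY_t$. *)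

(* Defs.v *)
From HB Require Import structures.
From mathcomp Require Import all_boot all_order all_algebra.
From mathcomp Require Import all_classical all_reals all_analysis.
From mathcomp Require Import complex.

Set Implicit Arguments.
Unset Strict Implicit.
Unset Printing Implicit Defensive.
Import Order.TTheory GRing.Theory Num.Theory.
Import numFieldNormedType.Exports.
Local Open Scope classical_set_scope.
Local Open Scope ring_scope.
Local Open Scope complex_scope.

(* R^d as column vectors, with the Borel sigma-algebra: MathComp-Analysis puts
   a topology but no sigma-algebra on matrices. *)
Notation borelRd R d := (g_sigma_algebraType (@open 'cV[R]_d)).

Section euclidean.
Context {R : realType} {d : nat}.
Implicit Types (t x : 'cV[R]_d) (A : 'M[R]_d).

Definition dotp t x : R := (t^T *m x) 0 0.

(* The library norm `|x| on matrices is the sup norm. *)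
Definition enorm x : R := Num.sqrt (dotp x x).

Definition quadf A t : R := (t^T *m A *m t) 0 0.

Definition psd A := A^T = A /\ forall t, 0 <= quadf A t.

End euclidean.

Section complex_integral.
Context {R : realType}.

Definition cexp (z : R[i]) : R[i] :=
  (expR (complex.Re z))%:C *
  (cos (complex.Im z) +i* sin (complex.Im z)).

Definition cintegral {dT} {T : measurableType dT}
    (mu : {measure set T -> \bar R}) (f : T -> R[i]) : R[i] :=
  (\int[mu]_x complex.Re (f x)) +i* (\int[mu]_x complex.Im (f x)).

End complex_integral.

Section random_vectors.
Context {R : realType}.

Definition same_law {dT dT' dE} {T : measurableType dT} {T' : measurableType dT'}
    {E : measurableType dE} {P : probability T R} {P' : probability T' R}
    (X : {RV P >-> E}) (X' : {RV P' >-> E}) :=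
  forall S : set E, measurable S -> distribution P X S = distribution P' X' S.

(* Since S i may be the whole space, the product rule over all n indices
   contains the product rule over every subfamily. *)
Definition mutually_independent {dT dE} {T : measurableType dT}
    {E : measurableType dE} {P : probability T R} {n : nat}
    (Y : 'I_n -> {RV P >-> E}) :=
  forall S : 'I_n -> set E, (forall i, measurable (S i)) ->
    P [set w | forall i, S i (Y i w)] = (\prod_(i < n) P (Y i @^-1` S i))%E.

Definition independent2 {dT dE dF} {T : measurableType dT}
    {E : measurableType dE} {F : measurableType dF} {P : probability T R}
    (Y : {RV P >-> E}) (Z : {RV P >-> F}) :=
  forall (S : set E) (S' : set F), measurable S -> measurable S' ->
    P (Y @^-1` S `&` Z @^-1` S') = (P (Y @^-1` S) * P (Z @^-1` S'))%E.

Context {d : nat} {dT : measure_display} {T : measurableType dT}.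

Definition infinitely_divisible {P : probability T R}
    (X : {RV P >-> borelRd R d}) :=
  forall n : nat, (0 < n)%N ->
  exists (dW : measure_display) (W : measurableType dW) (Q : probability W R)
      (Y : 'I_n -> {RV Q >-> borelRd R d}),
    [/\ mutually_independent Y,
        forall i j, same_law (Y i) (Y j) &
        forall S : set (borelRd R d), measurable S ->
          Q [set w | S (\sum_(i < n) (Y i w : 'cV[R]_d))] = distribution P X S].

Definition finite_second_moment {P : probability T R}
    (X : {RV P >-> borelRd R d}) : Prop :=
  ('E_P[(fun w => enorm (X w) ^+ 2)%R] < +oo)%E.

Definition centered {P : probability T R} (X : {RV P >-> borelRd R d}) :=
  forall i : 'I_d, ('E_P[(fun w => (X w : 'cV[R]_d) i 0)%R] = 0)%E.

Definition charfun {P : probability T R} (X : {RV P >-> borelRd R d})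
    (t : 'cV[R]_d) : R[i] :=
  cintegral P (fun w => cexp ('i%C * (dotp t (X w))%:C)).

End random_vectors.

Section levy.
Context {R : realType} {d : nat}.
Implicit Types (A : 'M[R]_d) (b t : 'cV[R]_d)
  (nu : {measure set (borelRd R d) -> \bar R}).

Definition levy_measure nu :=
  nu [set 0] = 0%E /\ (\int[nu]_x (Num.min 1 (enorm x ^+ 2))%:E < +oo)%E.

(* Levy-Khintchine exponent, with the truncation function 1_{|x| <= 1}. *)
Definition levy_exponent b A nu t : R[i] :=
  'i%C * (dotp b t)%:C - (quadf A t / 2)%:C +
  cintegral nu (fun x => cexp ('i%C * (dotp t x)%:C) - 1
    - 'i%C * (dotp t x * \1_[set y : 'cV[R]_d | enorm y <= 1] x)%:C).

Definition levy_triplet {dT} {T : measurableType dT} {P : probability T R}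
    (X : {RV P >-> borelRd R d}) b A nu :=
  [/\ psd A, levy_measure nu &
      forall t, charfun X t = cexp (levy_exponent b A nu t)].

Definition covariance_mx A nu : 'M[R]_d :=
  A + \matrix_(i < d, j < d) \int[nu]_x ((x : 'cV[R]_d) i 0 * (x : 'cV[R]_d) j 0).

Definition dvariance A nu t : R := quadf (covariance_mx A nu) t.

Definition dmeasure A nu t (S : set R) : \bar R :=
  ((quadf A t)%:E * \d_(0%R : R) S
   + \int[nu]_x (\1_S (dotp t x) * dotp t x ^+ 2)%:E)%E.

(* rho is the law of the directional remainder R_t = B Y_t. *)
Definition remainder_law A nu t (rho : probability R R) :=
  exists (dW : measure_display) (W : measurableType dW) (Q : probability W R)
      (Y B : {RV Q >-> R}),
    [/\ forall S : set R, measurable S ->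
          distribution Q Y S = (((dvariance A nu t)^-1)%:E * dmeasure A nu t S)%E,
        forall S : set R, measurable S ->
          distribution Q B S =
          (\int[lebesgue_measure]_(b in S) (2 * (1 - b) * \1_(`]0, 1[) b)%:E)%E,
        independent2 B Y &
        forall S : set R, measurable S -> rho S = Q [set w | S (B w * Y w)]].

End levy.

(* Main.v *)
(* For a unit vector u, let V = V_X(u) and R = B Y.  Because
     int_0^1 2 (1 - b) e^(i b z) db = 2 (1 + i z - e^(i z)) / z^2
   and the law of Y carries the factor <u, x>^2 / V, integrating out B and then Y
   gives - (s^2 / 2) V E e^(i s R) = psi(s u), where
     psi(t) = - t^T A t / 2 + int (e^(i<t,x>) - 1 - i<t,x>) nu(dx)
   is the logarithm of the characteristic function.  So psi is known everywhere,
   being 0 along the directions with V = 0.  The second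
   difference psi(t + h) + psi(t - h) - 2 psi(t) is, up to sign, the Fourier
   transform at t of the finite measure
   h^T A h delta_0 + 2 (1 - cos <h, x>) nu(dx), so that this measure is known for
   every h; its atom at 0 gives A, the rest gives nu.  The drift is then fixed by
   centering, and the characteristic function gives the law.

   A finite measure on R^d is recovered from its Fourier transform without
   Fourier inversion: products of cosines, bounded limits of polynomials in
   sin ((x_i - a) / n) and hence indicators of half-spaces {x_i > a} are all
   determined.  That nu has a second moment follows from the expansion of the
   characteristic function of X at 0. *)
Require Import Defs.
From mathcomp Require Import all_boot all_order all_algebra.
From mathcomp Require Import all_classical all_reals all_analysis.
From mathcomp Require Import measurable_realfun complex.
From mathcomp Require Import ring lra.
Import Order.TTheory GRing.Theory Num.Theory.
Import numFieldNormedType.Exports.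
Local Open Scope classical_set_scope.
Local Open Scope ring_scope.
Local Open Scope complex_scope.
Set Implicit Arguments.
Unset Strict Implicit.
Unset Printing Implicit Defensive.

(** * Linear functionals on bounded measurable functions, continuous under bounded limits *)

Section bounded_functional.
Import HBNNSimple.
Context {R : realType} {dT : measure_display} {T : measurableType dT}.
Implicit Types (F G : T -> R) (L : (T -> R) -> R).

Definition bounded_measurable F :=
  measurable_fun setT F /\ exists M : R, forall x, `|F x| <= M.

Lemma bounded_measurable_cst (a : R) : bounded_measurable (fun=> a).
Proof. by split; [exact: measurable_cst|exists `|a|]. Qed.

Lemma bounded_measurableD F G : bounded_measurable F -> bounded_measurable G ->
  bounded_measurable (fun x => F x + G x).
Proof.
move=> [mF [M FM]] [mG [N GN]]; split; first exact: measurable_funD.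
by exists (M + N) => x; rewrite (le_trans (ler_normD _ _))// lerD.
Qed.

Lemma bounded_measurableM F G : bounded_measurable F -> bounded_measurable G ->
  bounded_measurable (fun x => F x * G x).
Proof.
move=> [mF [M FM]] [mG [N GN]]; split; first exact: measurable_funM.
by exists (M * N) => x; rewrite normrM ler_pM.
Qed.

Lemma bounded_measurableZ (a : R) F : bounded_measurable F ->
  bounded_measurable (fun x => a * F x).
Proof. by apply: bounded_measurableM; exact: bounded_measurable_cst. Qed.

Lemma bounded_measurable_lin (a : R) F G :
  bounded_measurable F -> bounded_measurable G ->
  bounded_measurable (fun x => a * F x + G x).
Proof. by move=> /(bounded_measurableZ a); exact: bounded_measurableD. Qed.

Lemma bounded_measurable_indic (S : set T) : measurable S ->
  bounded_measurable \1_S.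
Proof.
move=> mS; split; first exact: measurable_indic.
by exists 1 => x; rewrite indicE; case: (_ \in _); rewrite ?normr1 ?normr0.
Qed.

(* Integrals against a finite measure, possibly plus an atom; these functionals
   are compared instead of the measures, so no measure with density has to be
   constructed. *)
Definition bounded_functional L :=
  (forall (a : R) F G, bounded_measurable F -> bounded_measurable G ->
     L (fun x => a * F x + G x) = a * L F + L G) /\
  (forall (F_ : nat -> T -> R) F (M : R),
     (forall n, measurable_fun setT (F_ n)) ->
     (forall n x, `|F_ n x| <= M) ->
     (forall x, F_ n x @[n --> \oo] --> F x) ->
     L (F_ n) @[n --> \oo] --> L F).


Lemma bounded_limit_measurable (F_ : nat -> T -> R) F (M : R) :
  (forall n, measurable_fun setT (F_ n)) ->
  (forall n x, `|F_ n x| <= M) ->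
  (forall x, F_ n x @[n --> \oo] --> F x) ->
  measurable_fun setT F /\ forall x, `|F x| <= M.
Proof.
move=> mF FM cF; split.
  by apply: (measurable_fun_cvg mF) => // x _; exact: cF.
move=> x; have cFx : `|F_ n x| @[n --> \oo] --> `|F x| by apply: cvg_norm; exact: cF.
rewrite -(cvg_lim _ cFx)//; apply: limr_le; first by apply/cvg_ex; exists `|F x|.
by apply: nearW => n; exact: FM.
Qed.

(** Dominated convergence with bound [M * |w|]; [mu] may be infinite as long as [w] is integrable.
    The shape (an atom, a push-forward by [phi], a density [w]) covers expectations, the density of
    B, the law of Y and the second differences alike. *)
Lemma weighted_functional {dU : measure_display} {U : measurableType dU}
    (mu : {measure set U -> \bar R}) (phi : U -> T) (w : U -> R) (c : R)
    (x0 : T) :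
  measurable_fun setT phi -> mu.-integrable setT (EFin \o w) ->
  bounded_functional (fun F => c * F x0 + \int[mu]_u (F (phi u) * w u)).
Proof.
move=> mphi iw.
have mw : measurable_fun setT w by apply/measurable_EFinP; exact: measurable_int iw.
have iFw F M : measurable_fun setT F -> (forall x, `|F x| <= M) ->
    mu.-integrable setT (EFin \o (fun u => F (phi u) * w u)).
  move=> mF FM.
  apply: (@le_integrable _ _ _ mu _ measurableT _ (fun u => M%:E * (w u)%:E)%E).
  - apply/measurable_EFinP; apply: measurable_funM => //.
    exact: measurableT_comp.
  - move=> u _ /=; rewrite lee_fin !normrM; apply: ler_wpM2r => //.
    exact: le_trans (ler_norm M).
  - exact: integrableZl.
split=> [a F G [mF [M FM]] [mG [N GN]]|F_ F M mF FM cF].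
  have -> : (fun u => (a * F (phi u) + G (phi u)) * w u) =
            (fun u => a * (F (phi u) * w u) + G (phi u) * w u).
    by apply/funext => u; rewrite mulrDl mulrA.
  rewrite RintegralD//; [|exact: (integrableZl measurableT a (iFw _ _ mF FM))|exact: iFw GN].
  by rewrite RintegralZl//; [ring|exact: iFw FM].
apply: cvgD; first by apply: cvgM; [exact: cvg_cst|exact: cF].
rewrite /Rintegral.
have [mF' FM'] := bounded_limit_measurable mF FM cF.
apply: fine_cvg.
rewrite fineK; last by apply: integrable_fin_num => //; exact: iFw FM'.
have [|||||_ _] := @dominated_convergence _ _ R mu setT measurableT
  (fun n u => (F_ n (phi u) * w u)%:E) (fun u => (F (phi u) * w u)%:E)
  (fun u => (M * `|w u|)%:E).
- by move=> n; apply: measurable_int (iFw _ _ _ (FM n)).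
- apply: measurable_int (iFw _ _ _ (FM')) => //.
- apply: aeW => u _; apply: cvg_EFin; first by near=> n.
  by apply: cvgM; [exact: cF|exact: cvg_cst].
- have := integrableZl measurableT M (integrable_abse iw).
  by apply: eq_integrable.
- apply: aeW => u n _ /=; rewrite lee_fin normrM ler_wpM2r//.
by [].
Unshelve. all: by end_near.
Qed.

(** The standard extension: indicators, then simple functions by linearity, then nonnegative bounded
    functions by increasing simple approximation, then all bounded functions by a shift. *)
Lemma eq_bounded_functional L L' :
  bounded_functional L -> bounded_functional L' ->
  (forall S, measurable S -> L \1_S = L' \1_S) ->
  forall F, bounded_measurable F -> L F = L' F.
Proof.
move=> [Llin Lcvg] [L'lin L'cvg] LL'.
have L0 : L (fun=> 0) = L' (fun=> 0).
  have -> : (fun=> 0) = \1_(@set0 T) :> (T -> R) by apply/funext => x; rewrite indic0.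
  exact: LL'.
have LD F G : bounded_measurable F -> bounded_measurable G ->
    L F = L' F -> L G = L' G -> forall a : R, L (fun x => a * F x + G x) =
      L' (fun x => a * F x + G x).
  by move=> bF bG LF LG a; rewrite Llin// L'lin// LF LG.
have Lpos F (M : R) : measurable_fun setT F -> (forall x, 0 <= F x <= M) -> L F = L' F.
  move=> mF FM.
  have mF' : measurable_fun setT (EFin \o F) by exact/measurable_EFinP.
  pose f n x : R := nnsfun_approx measurableT mF' n x.
  have F0 x : setT x -> (0 <= (EFin \o F) x)%E by move=> _ /=; rewrite lee_fin;
    case/andP: (FM x).
  have cf x : f n x @[n --> \oo] --> F x.
    have := @cvg_nnsfun_approx _ _ _ _ measurableT _ mF' F0 x Logic.I.
    by move/fine_cvg.
  have fM n x : `|f n x| <= M.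
    rewrite ger0_norm//.
    have ndf : nondecreasing_seq (f ^~ x).
      by move=> i j ij; have /lefP := nd_nnsfun_approx measurableT mF' ij; exact.
    have := nondecreasing_cvgn_le ndf _ n; rewrite (cvg_lim _ (cf x))//.
    move=> /(_ (cf x))/le_trans; apply; by case/andP: (FM x).
  have mf n : measurable_fun setT (f n) by exact: measurable_funP.
  have Lf n : L (f n) = L' (f n).
    rewrite /f; set g := nnsfun_approx _ _ n; change (L g = L' g).
    have [s ->] : exists s : seq R, (g : T ->
      R) = (fun x => \sum_(y <- s) (y * \1_(g @^-1` [set y]) x)).
      by eexists; apply/funext => x; rewrite (fimfunE g) fsbig_finite.
    suff : bounded_measurable (fun x => \sum_(y <- s) (y * \1_(g @^-1` [set y]) x)) /\
       L (fun x => \sum_(y <- s) (y * \1_(g @^-1` [set y]) x)) =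
         L' (fun x => \sum_(y <- s) (y * \1_(g @^-1` [set y]) x)).
      by case.
    elim: s => [|y s [bs IH]].
      under [X in bounded_measurable X]eq_fun do rewrite big_nil.
      under [X in L X]eq_fun do rewrite big_nil.
      under [X in L' X]eq_fun do rewrite big_nil.
      by split; first exact: bounded_measurable_cst.
    under [X in bounded_measurable X]eq_fun do rewrite big_cons.
    under [X in L X]eq_fun do rewrite big_cons.
    under [X in L' X]eq_fun do rewrite big_cons.
    have mg : measurable (g @^-1` [set y]) by exact: measurable_funPTI.
    have bi := bounded_measurable_indic mg.
    by split; [exact: bounded_measurable_lin|apply: LD => //; exact: LL'].
  apply: (@cvg_unique _ _ (L (f n) @[n --> \oo])) => //; first exact: Lcvg fM cf.
  rewrite (_ : (fun n => L (f n)) = (fun n => L' (f n))); last exact/funext.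
  exact: L'cvg fM cf.
move=> F [mF [M FM]].
have mFM : measurable_fun setT (fun x => F x + M) by apply: measurable_funD.
have bFM : forall x, 0 <= F x + M <= M + M.
  by move=> x; have := FM x; rewrite ler_norml => /andP[? ?]; rewrite lerD2r; apply/andP;
    split=> //; lra.
(* The shifted function [F + M] takes values in [0, 2M], so the nonnegative case applies to it. *)
have -> : F = (fun x => (- M) * \1_setT x + (F x + M)).
  by apply/funext => x; rewrite indicT mulr1; lra.
apply: LD; [exact: bounded_measurable_indic| |exact: LL'|exact: Lpos bFM].
split=> //; exists (M + M) => x; have /andP[? ?] := bFM x; by rewrite ger0_norm.
Qed.

End bounded_functional.

(** * Approximation of the sign by polynomials *)

Section cubic.
Context {R : realType}.
Implicit Types u : R.

(* The iterates of this polynomial converge boundedly on [-1, 1] to the sign. *)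
Definition cubic u : R := (3 * u - u ^+ 3) / 2.

Lemma cubicN u : cubic (- u) = - cubic u.
Proof. by rewrite /cubic; field. Qed.

Lemma iter_cubicN n u : iter n cubic (- u) = - iter n cubic u.
Proof. by elim: n => //= n ->; rewrite cubicN. Qed.

Lemma iter_cubic0 n : iter n cubic 0 = 0.
Proof. by elim: n => //= n ->; rewrite /cubic mulr0 expr0n /= subr0 mul0r. Qed.

(** For v in (0, 1], [cubic v - v = v (1 - v) (1 + v) / 2] is nonnegative, so the orbit increases
    from u and stays below 1. The distance to 1 is multiplied by
    [(1 - v) (2 + v) / 2 = 1 - (v + v^2) / 2], at most [1 - u / 2] because v >= u. *)
Lemma iter_cubic_ge n u : 0 < u -> u <= 1 ->
  (u <= iter n cubic u <= 1) /\ 1 - iter n cubic u <= (1 - u / 2) ^+ n.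
Proof.
move=> u0 u1; elim: n => [|n [/andP[IH1 IH2] IH3]]; first by rewrite /= expr0 lexx u1;
  split => //; lra.
set v := iter n cubic u in IH1 IH2 IH3 *.
rewrite iterS -/v exprS.
have -> : 1 - cubic v = ((1 - v) * (2 + v) / 2) * (1 - v) by rewrite /cubic; field.
have vE : cubic v - v = v * (1 - v) * (1 + v) / 2 by rewrite /cubic; field.
have v1E : 1 - cubic v = ((1 - v) ^+ 2) * (2 + v) / 2 by rewrite /cubic; field.
split.
  apply/andP; split.
    rewrite (le_trans IH1)// -subr_ge0 vE; apply: divr_ge0 => //; apply: mulr_ge0; last lra.
    by apply: mulr_ge0; lra.
  rewrite -subr_ge0 v1E; apply: divr_ge0 => //; apply: mulr_ge0; last lra.
  exact: sqr_ge0.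
apply: ler_pM => //; first by apply: divr_ge0 => //; apply: mulr_ge0; lra.
  by lra.
rewrite -subr_ge0.
have -> : 1 - u / 2 - (1 - v) * (2 + v) / 2 = (v ^+ 2 + (v - u)) / 2 by field.
by apply: divr_ge0 => //; apply: addr_ge0; [exact: sqr_ge0|lra].
Qed.

Lemma iter_cubic_bound n u : `|u| <= 1 -> `|iter n cubic u| <= 1.
Proof.
have pos v : 0 < v -> v <= 1 -> `|iter n cubic v| <= 1.
  by move=> v0 v1; have [/andP[? ?] _] := iter_cubic_ge n v0 v1; rewrite ger0_norm//; lra.
move=> u1; have [u0|u0|->] := ltgtP u 0.
- by rewrite -[u]opprK iter_cubicN normrN pos ?oppr_gt0//; rewrite ler_norml in u1; lra.
- by rewrite pos//; rewrite ler_norml in u1; lra.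
- by rewrite iter_cubic0 normr0.
Qed.

Lemma iter_cubic_cvg u : `|u| <= 1 -> iter n cubic u @[n --> \oo] --> Num.sg u.
Proof.
have pos v : 0 < v -> v <= 1 -> iter n cubic v @[n --> \oo] --> (1 : R).
  move=> v0 v1.
  apply: (@squeeze_cvgr _ _ _ _ (fun n => 1 - (1 - v / 2) ^+ n) (fun=> 1)).
  - by apply: nearW => n; have [/andP[? ?] ?] := iter_cubic_ge n v0 v1; apply/andP; split; lra.
  - rewrite -[X in _ --> X]subr0; apply: cvgB; first exact: cvg_cst.
    by apply: cvg_expr; rewrite ger0_norm; lra.
  - exact: cvg_cst.
move=> u1; have [u0|u0|->] := ltgtP u 0.
- rewrite ltr0_sg// (_ : (fun n => iter n cubic u) = (fun n => - iter n cubic (- u))).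
    2: by apply/funext => n; rewrite iter_cubicN opprK.
  by apply: cvgN; apply: pos; rewrite ler_norml in u1; lra.
- by rewrite gtr0_sg//; apply: pos => //; rewrite ler_norml in u1; lra.
- by rewrite sgr0; under eq_fun do rewrite iter_cubic0; exact: cvg_cst.
Qed.

(** Eventually [y / n.+1] lies in (-pi, pi), where the sine has the sign of its argument; the
    sequence is then constant. *)
Lemma sgr_sin_cvg (y : R) : Num.sg (sin (y / n.+1%:R)) @[n --> \oo] --> Num.sg y.
Proof.
have pos z : 0 < z -> Num.sg (sin (z / n.+1%:R)) @[n --> \oo] --> (1 : R).
  move=> z0; apply: cvg_near_cst; near=> n.
  rewrite gtr0_sg//; apply: sin_gt0_pi; rewrite divr_gt0//=.
  apply: lt_le_trans (pi_ge2 R); rewrite ltr_pdivrMr//.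
  have nz : z < n%:R by near: n; exact: nbhs_infty_gtr.
  by rewrite (lt_le_trans nz)// mulrC -natr1 mulrDl mul1r; have := ler0n R n; lra.
have [y0|y0|->] := ltgtP y 0.
- rewrite ltr0_sg// (_ : (fun n => Num.sg (sin (y / n.+1%:R))) =
    (fun n => - Num.sg (sin (- y / n.+1%:R)))).
    2: by apply/funext => n; rewrite mulNr sinN sgrN opprK.
  by apply: cvgN; apply: pos; rewrite oppr_gt0.
- by rewrite gtr0_sg//; exact: pos.
- by rewrite sgr0; under eq_fun do rewrite mul0r sin0 sgr0; exact: cvg_cst.
Unshelve. all: by end_near.
Qed.

End cubic.

(** * Scalar products and the functions cos (<t, x> + theta) *)

Section waves.
Context {R : realType} {d : nat}.
Implicit Types (t h x : 'cV[R]_d) (F G : borelRd R d -> R).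

Lemma dotpE t x : dotp t x = \sum_(i < d) t i 0 * x i 0.
Proof. by rewrite /dotp mxE; apply: eq_bigr => i _; rewrite mxE. Qed.

Lemma dotpDl t h x : dotp (t + h) x = dotp t x + dotp h x.
Proof. by rewrite /dotp raddfD mulmxDl mxE. Qed.

Lemma dotpNl t x : dotp (- t) x = - dotp t x.
Proof. by rewrite /dotp raddfN mulNmx mxE. Qed.

Lemma dotpZl (a : R) t x : dotp (a *: t) x = a * dotp t x.
Proof. by rewrite /dotp linearZ -scalemxAl mxE. Qed.

Lemma dotp_delta (i : 'I_d) x : dotp (delta_mx i 0) x = x i 0.
Proof.
rewrite dotpE (bigD1 i)//= mxE !eqxx mul1r big1 ?addr0// => j /negPf ji.
by rewrite mxE ji mul0r.
Qed.

Lemma measurable_coord (i : 'I_d) :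
  measurable_fun setT (fun x : borelRd R d => (x : 'cV[R]_d) i 0).
Proof.
apply: (measurability _ (RGenOInfty.measurableE R)) => //.
move=> _ [_ [a ->] <-]; rewrite setTI; apply: sub_sigma_algebra.
move: (@coord_continuous R d 1 i 0) => /continuousP; apply.
rewrite (_ : [set` _] = [set x | a < x]); first exact: open_gt.
by apply/seteqP; split => x /=; rewrite in_itv/= andbT.
Qed.

Lemma measurable_dotp t :
  measurable_fun setT (fun x : borelRd R d => dotp t (x : 'cV[R]_d)).
Proof.
under eq_fun do rewrite dotpE.
apply: measurable_sum => i; apply: measurable_funM => //.
exact: measurable_coord.
Qed.

(** The phase lets one real family carry both parts of e^(i<t,x>): phase 0 gives the cosine and
    phase -pi/2 the sine. *)
Definition wave t (theta : R) : borelRd R d -> R := fun x => cos (dotp t x + theta).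

Lemma bounded_measurable_wave t theta : bounded_measurable (wave t theta).
Proof.
split.
  apply: (@measurableT_comp _ _ _ _ _ _ (@cos R)).
    by apply: continuous_measurable_fun; exact: continuous_cos.
  by apply: measurable_funD => //; exact: measurable_dotp.
by exists 1 => x; rewrite ler_norml cos_geN1 cos_le1.
Qed.

Lemma waveM t h (theta eta : R) x : wave t theta x * wave h eta x =
  2^-1 * wave (t + h) (theta + eta) x + 2^-1 * wave (t - h) (theta - eta) x.
Proof.
rewrite /wave !dotpDl dotpNl.
have -> : dotp t x + dotp h x + (theta + eta) = (dotp t x + theta) + (dotp h x + eta) by ring.
have -> : dotp t x - dotp h x + (theta - eta) = (dotp t x + theta) - (dotp h x + eta) by ring.
by move: (_ + theta) (_ + eta) => a b; rewrite (cosD a) (cosB a); field.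
Qed.

(** * Functionals that agree on all waves agree on all bounded measurable functions *)

Section multiplier.
Variables L L' : (borelRd R d -> R) -> R.
Hypotheses (bL : bounded_functional L) (bL' : bounded_functional L').

(** Asking for agreement after multiplication by every wave, and not only for [L F = L' F], makes
    the property stable under products with waves; [t = 0], [theta = 0] gives back [L F = L' F]. *)
Definition agree F := bounded_measurable F /\
  forall t theta, L (fun x => F x * wave t theta x) =
                  L' (fun x => F x * wave t theta x).

(* Multipliers form an algebra closed under bounded limits, hence the sets whose
   indicator is a multiplier form a sigma-algebra. *)
Definition multiplier G := bounded_measurable G /\
  forall F, agree F -> agree (fun x => F x * G x).

Lemma agree_lin (a : R) F G : agree F -> agree G -> agree (fun x => a * F x + G x).
Proof.
move=> [bF LF] [bG LG]; split; first exact: bounded_measurable_lin.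
move=> t theta.
have -> : (fun x => (a * F x + G x) * wave t theta x) =
    (fun x => a * (F x * wave t theta x) + G x * wave t theta x).
  by apply/funext => x; rewrite mulrDl mulrA.
have bw := bounded_measurable_wave t theta.
by rewrite bL.1 ?bL'.1 ?LF ?LG//; exact: bounded_measurableM.
Qed.

Lemma agree_wave t theta F : agree F -> agree (fun x => F x * wave t theta x).
Proof.
move=> [bF LF]; have bw := bounded_measurable_wave.
split=> [|h eta]; first exact: bounded_measurableM.
have -> : (fun x => F x * wave t theta x * wave h eta x) =
    (fun x => 2^-1 * (F x * wave (t + h) (theta + eta) x) +
              2^-1 * (F x * wave (t - h) (theta - eta) x)).
  by apply/funext => x; rewrite -mulrA waveM; ring.
rewrite bL.1 ?bL'.1; try by [exact:
  bounded_measurableM|exact/bounded_measurableZ/bounded_measurableM].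
have Z c G : bounded_measurable G -> L G = L' G -> L (fun x => c * G x) = L' (fun x => c * G x).
  move=> bG LG.
  (* Linearity with coefficient -1 at the zero function gives [L 0 = 0] and [L' 0 = 0]; homogeneity
     is then the case of a zero second summand. *)
  have b0 := bounded_measurable_cst (0 : R) (T := borelRd R d).
  have := bL.1 (-1) _ _ b0 b0.
  have := bL'.1 (-1) _ _ b0 b0.
  rewrite mulr0 addr0 => L'0 L0.
  have -> : (fun x => c * G x) = (fun x => c * G x + 0) by apply/funext => x; rewrite addr0.
  by rewrite bL.1// bL'.1// LG; congr (_ + _); lra.
by congr (_ * _ + _); [exact: LF|apply: Z; [exact: bounded_measurableM|exact: LF]].
Qed.

Lemma multiplier_wave t theta : multiplier (wave t theta).
Proof. by split; [exact: bounded_measurable_wave|move=> F; exact: agree_wave]. Qed.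

Lemma multiplierM F G : multiplier F -> multiplier G -> multiplier (fun x => F x * G x).
Proof.
move=> [bF mF] [bG mG]; split; first exact: bounded_measurableM.
move=> H /mF/mG; rewrite (_ : (fun x => H x * F x * G x) = (fun x => H x * (F x * G x)))//.
by apply/funext => x; rewrite mulrA.
Qed.

Lemma multiplier_lin (a : R) F G :
  multiplier F -> multiplier G -> multiplier (fun x => a * F x + G x).
Proof.
move=> [bF mF] [bG mG]; split; first exact: bounded_measurable_lin.
move=> H aH; have := agree_lin a (mF _ aH) (mG _ aH).
rewrite (_ : (fun x => a * (H x * F x) + H x * G x) = (fun x => H x * (a * F x + G x)))//.
by apply/funext => x; ring.
Qed.

Lemma multiplier1 : multiplier (fun=> 1).
Proof.
split; first exact: bounded_measurable_cst.
by move=> F; rewrite (_ : (fun x => F x * 1) = F)//; apply/funext => x; rewrite mulr1.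
Qed.

Lemma multiplier_cst (a : R) : multiplier (fun=> a).
Proof.
rewrite (_ : (fun=> a) = (fun x : borelRd R d => (a - 1) * 1 + 1));
  last by apply/funext => x; lra.
by apply: multiplier_lin; exact: multiplier1.
Qed.

(** The products [F * G_ n * wave] are bounded by [N * M], where N bounds F, so both functionals
    pass to the limit. *)
Lemma multiplier_lim (G_ : nat -> borelRd R d -> R) G (M : R) :
  (forall n, multiplier (G_ n)) -> (forall n x, `|G_ n x| <= M) ->
  (forall x, G_ n x @[n --> \oo] --> G x) -> multiplier G.
Proof.
move=> mG GM cG.
have [mG' GM'] := bounded_limit_measurable (fun n => (mG n).1.1) GM cG.
have bG : bounded_measurable G by split => //; exists M.
split=> // F aF; have [bF _] := aF; split; first exact: bounded_measurableM.
move=> t theta; have [mF [N FN]] := bF; have bw := bounded_measurable_wave t theta.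
pose H n : borelRd R d -> R := fun x => F x * G_ n x * wave t theta x.
have mH n : measurable_fun setT (H n).
  by apply: measurable_funM; [apply: measurable_funM => //; exact: (mG n).1.1|exact: bw.1].
have HM n x : `|H n x| <= N * M.
  rewrite /H normrM -[leRHS]mulr1; apply: ler_pM => //.
    by rewrite normrM; apply: ler_pM.
  by rewrite ler_norml cos_geN1 cos_le1.
have cH x : H n x @[n --> \oo] --> F x * G x * wave t theta x.
  by apply: cvgM; [apply: cvgM; [exact: cvg_cst|exact: cG]|exact: cvg_cst].
have LH n : L (H n) = L' (H n) by exact: ((mG n).2 F aF).2.
apply: (@cvg_unique _ _ (L (H n) @[n --> \oo])) => //; first exact: bL.2 mH HM cH.
rewrite (_ : (fun n => L (H n)) = (fun n => L' (H n))); last exact/funext.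
exact: bL'.2 mH HM cH.
Qed.

(** The sine is a wave, the iterates of [cubic] at it are polynomials in a multiplier, and they
    converge boundedly to its sign. *)
Lemma multiplier_sg_sin h (a : R) :
  multiplier (fun x => Num.sg (sin (dotp h x - a))).
Proof.
have ms : multiplier (fun x => sin (dotp h x - a)).
  have := multiplier_wave h (- a - pi / 2).
  rewrite (_ : wave _ _ = (fun x => sin (dotp h x - a)))//.
  by apply/funext => x; rewrite /wave addrA cosBpihalf.
have s1 x : `|sin (dotp h x - a)| <= 1 by rewrite ler_norml sin_geN1 sin_le1.
apply: (@multiplier_lim (fun n x => iter n cubic (sin (dotp h x - a))) _ 1).
- elim=> [|n IH] //=.
  rewrite (_ : (fun x => _) = (fun x =>
    (- 2^-1) * (iter n cubic (sin (dotp h x - a)) * iter n cubic (sin (dotp h x - a))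
     * iter n cubic (sin (dotp h x - a))) + ((3 / 2) * iter n cubic (sin (dotp h x - a)) + 0))).
    by apply: multiplier_lin; [do 2 apply: multiplierM => //|apply: multiplier_lin => //;
      exact: multiplier_cst].
  by apply/funext => x; rewrite /cubic; field.
- by move=> n x; exact: iter_cubic_bound.
- by move=> x; exact: iter_cubic_cvg.
Qed.

(** The coordinate is unbounded, so its sign is reached through the bounded functions sin ((x_i - a)
    / (n + 1)), which come from the direction e_i / (n + 1). *)
Lemma multiplier_sg (i : 'I_d) (a : R) :
  multiplier (fun x => Num.sg ((x : 'cV[R]_d) i 0 - a)).
Proof.
apply: (@multiplier_lim (fun n x => Num.sg (sin (((x : 'cV[R]_d) i 0 - a) / n.+1%:R))) _ 1).
- move=> n; have := multiplier_sg_sin (n.+1%:R^-1 *: delta_mx i 0) (a / n.+1%:R).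
  rewrite (_ : (fun x => _) = (fun x => Num.sg (sin (((x : 'cV[R]_d) i 0 - a) / n.+1%:R))))//.
  by apply/funext => x; rewrite dotpZl dotp_delta mulrBl mulrC.
- by move=> n x; rewrite normr_sg; case: (_ != _); rewrite ?lexx ?ler01.
- by move=> x; exact: sgr_sin_cvg.
Qed.

Definition multiplier_set (S : set (borelRd R d)) := measurable S /\ multiplier \1_S.

Lemma measurable_coord_gt (i : 'I_d) (a : R) :
  measurable [set x : borelRd R d | a < (x : 'cV[R]_d) i 0].
Proof.
rewrite (_ : [set _ | _] = (fun x : borelRd R d => (x : 'cV[R]_d) i 0) @^-1` `]a, +oo[).
  by rewrite -[X in measurable X]setTI; exact: measurable_coord.
by apply/seteqP; split => x /=; rewrite in_itv/= andbT.
Qed.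

Lemma measurable_coord_lt (i : 'I_d) (a : R) :
  measurable [set x : borelRd R d | (x : 'cV[R]_d) i 0 < a].
Proof.
rewrite (_ : [set _ | _] = (fun x : borelRd R d => (x : 'cV[R]_d) i 0) @^-1` `]-oo, a[).
  by rewrite -[X in measurable X]setTI; exact: measurable_coord.
by apply/seteqP; split => x /=; rewrite in_itv.
Qed.

Lemma multiplier_set_gt (i : 'I_d) (a : R) :
  multiplier_set [set x : borelRd R d | a < (x : 'cV[R]_d) i 0].
Proof.
split; first exact: measurable_coord_gt.
have ms := multiplier_sg i a.
(* With s the sign of x_i - a, (s^2 + s) / 2 is 1 for s = 1 and 0 for s = 0 or -1; the opposite
   half-space uses (s^2 - s) / 2. *)
rewrite (_ : \1__ = (fun x : borelRd R d =>
  2^-1 * (Num.sg ((x : 'cV[R]_d) i 0 - a) * Num.sg ((x : 'cV[R]_d) i 0 - a)) +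
   (2^-1 * Num.sg ((x : 'cV[R]_d) i 0 - a) + 0))).
  apply: multiplier_lin; first exact: multiplierM.
  by apply: multiplier_lin => //; exact: multiplier_cst.
apply/funext => x; rewrite indicE; have [h|h] := ltP a ((x : 'cV[R]_d) i 0).
  by rewrite mem_set//= gtr0_sg ?subr_gt0//=; field.
rewrite memNset/=; last by apply/negP; rewrite -leNgt.
move: h; rewrite le_eqVlt => /predU1P[->|h]; first by rewrite subrr sgr0; ring.
by rewrite ltr0_sg ?subr_lt0//; ring.
Qed.

Lemma multiplier_set_lt (i : 'I_d) (a : R) :
  multiplier_set [set x : borelRd R d | (x : 'cV[R]_d) i 0 < a].
Proof.
split; first exact: measurable_coord_lt.
have ms := multiplier_sg i a.
rewrite (_ : \1__ = (fun x : borelRd R d =>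
  2^-1 * (Num.sg ((x : 'cV[R]_d) i 0 - a) * Num.sg ((x : 'cV[R]_d) i 0 - a)) +
   (- 2^-1 * Num.sg ((x : 'cV[R]_d) i 0 - a) + 0))).
  apply: multiplier_lin; first exact: multiplierM.
  by apply: multiplier_lin => //; exact: multiplier_cst.
apply/funext => x; rewrite indicE; have [h|h] := ltP ((x : 'cV[R]_d) i 0) a.
  by rewrite mem_set//= ltr0_sg ?subr_lt0//=; field.
rewrite memNset/=; last by apply/negP; rewrite -leNgt.
move: h; rewrite le_eqVlt => /predU1P[->|h]; first by rewrite subrr sgr0; ring.
by rewrite gtr0_sg ?subr_gt0//; ring.
Qed.

Lemma multiplier_setC A : multiplier_set A -> multiplier_set (~` A).
Proof.
move=> [mA cA]; split; first exact: measurableC.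
rewrite (_ : \1__ = (fun x : borelRd R d => -1 * \1_A x + 1)).
  by apply: multiplier_lin => //; exact: multiplier1.
by apply/funext => x; rewrite !indicE in_setC; case: (x \in A) => /=; ring.
Qed.

Lemma multiplier_setI A B : multiplier_set A -> multiplier_set B -> multiplier_set (A `&` B).
Proof.
move=> [mA cA] [mB cB]; split; first exact: measurableI.
rewrite (_ : \1__ = (fun x : borelRd R d => \1_A x * \1_B x)); first exact: multiplierM.
by apply/funext => x; rewrite !indicE in_setI; case: (x \in A); case: (x \in B) => /=; ring.
Qed.

(** Finite unions follow from complements and intersections by De Morgan; a countable union is the
    bounded limit of its finite partial unions. *)
Lemma multiplier_set_sigma_algebra : sigma_algebra setT multiplier_set.
Proof.
have m0 : multiplier_set set0.
  by split=> //; rewrite (_ : \1__ = (fun=> 0)); [exact: multiplier_cst|apply/funext => x;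
    rewrite indic0].
have mD A : multiplier_set A -> multiplier_set (setT `\` A).
  by rewrite setTD; exact: multiplier_setC.
split=> // A mA.
have mU n : multiplier_set (\bigcup_(k < n) A k).
  elim: n => [|n IH]; first by rewrite bigcup_mkord big_ord0.
  rewrite bigcup_mkord big_ord_recr/= -bigcup_mkord -[X in multiplier_set X]setCK setCU.
  by apply: multiplier_setC; apply: multiplier_setI; exact: multiplier_setC.
split; first by apply: bigcup_measurable => k _; exact: (mA k).1.
apply: (@multiplier_lim (fun n => \1_(\bigcup_(k < n) A k)) _ 1).
- by move=> n; exact: (mU n).2.
- by move=> n x; rewrite indicE; case: (_ \in _); rewrite ?normr1 ?normr0.
move=> x; have [[k _ Akx]|nA] := pselect ((\bigcup_k A k) x).
  apply: cvg_near_cst; near=> n.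
  rewrite !indicE !mem_set//; first by exists k.
  by exists k => //=; near: n; exact: nbhs_infty_gt.
rewrite indicE memNset//.
rewrite (_ : (fun n => _) = (fun=> 0)); first exact: cvg_cst.
apply/funext => n; rewrite indicE memNset// => -[k _ Akx].
by apply: nA; exists k.
Unshelve. all: by end_near.
Qed.

(** These boxes are a countable base of the topology, which carries the property from half-spaces to
    open sets. *)
Definition rational_box (c : 'cV[rat]_d) (r : rat) : set (borelRd R d) :=
  \bigcap_(i in [set: 'I_d])
    ([set x : borelRd R d | ratr (c i 0) - ratr r < (x : 'cV[R]_d) i 0] `&`
     [set x : borelRd R d | (x : 'cV[R]_d) i 0 < ratr (c i 0) + ratr r]).

Lemma multiplier_rational_box c r : multiplier_set (rational_box c r).
Proof.
(* Being a sigma-algebra, [multiplier_set] is the one it generates, so finite intersections come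
   from the generated measurable structure. *)
have mE : <<s multiplier_set >> = multiplier_set.
  by apply: smallest_id; exact: multiplier_set_sigma_algebra.
rewrite -mE; apply: (@fin_bigcap_measurable _ (g_sigma_algebraType multiplier_set)).
  exact: finite_finset.
move=> i _; apply: sub_sigma_algebra; apply: multiplier_setI.
  exact: multiplier_set_gt.
exact: multiplier_set_lt.
Qed.

(** The radius is below e / 2 and the centre within r of x in each coordinate, so every point of the
    box is within 2 r < e of x in the sup norm. *)
Lemma open_rational_box (U : set 'cV[R]_d) (x : 'cV[R]_d) : open U -> U x ->
  exists c r, rational_box c r x /\ rational_box c r `<=` U.
Proof.
move=> oU Ux.
have /nbhs_ballP[e /= e0 eU] : nbhs x U by apply: open_nbhs_nbhs.
have [r] : exists r, ratr r \in `]0, (e / 2)[ by apply: rat_in_itvoo; lra.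
rewrite in_itv/= => /andP[r0 re].
have cP (i : 'I_d) : exists c : rat, `|ratr c - x i 0| < ratr r :> R.
  have [c] : exists c, ratr c \in `](x i 0 - ratr r),
    (x i 0 + ratr r)[ by apply: rat_in_itvoo; lra.
  by rewrite in_itv/= => /andP[c1 c2]; exists c; rewrite ltr_norml; apply/andP; split; lra.
pose c : 'cV[rat]_d := \col_i xchoose (cP i).
have cE i : `|ratr (c i 0) - x i 0| < ratr r :> R by rewrite mxE; exact: (xchooseP (cP i)).
exists c, r; split=> [i _ /=|y yb].
  by have := cE i; rewrite ltr_norml => /andP[? ?]; split; lra.
apply: eU; split => // i j; rewrite (ord1 j) /ball/=.
have [/= y1 y2] := yb i Logic.I; have := cE i; rewrite !ltr_norml => /andP[? ?].
by apply/andP; split; lra.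
Qed.

Lemma multiplier_open U : open U -> multiplier_set U.
Proof.
move=> oU.
(* Enumeration of the rational boxes inside [U]; a number that codes no box, or a box not inside
   [U], contributes the empty set. *)
pose B (k : nat) : set (borelRd R d) :=
  if unpickle k is Some (c, r) then
    if `[< rational_box c r `<=` U >] then rational_box c r else set0
  else set0.
have [m0 _ mU] := multiplier_set_sigma_algebra.
rewrite (_ : U = \bigcup_k B k).
  apply: mU => k; rewrite /B; case: unpickle => [[c r]|//].
  by case: ifP => // _; exact: multiplier_rational_box.
apply/seteqP; split => [x Ux|x [k _]].
  have [c [r [xb bU]]] := open_rational_box oU Ux.
  by exists (pickle (c, r)) => //; rewrite /B pickleK; case: asboolP.
by rewrite /B; case: unpickle => [[c r]|//]; case: asboolP => // bU; exact: bU.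
Qed.

Lemma multiplier_measurable (S : set (borelRd R d)) : measurable S -> multiplier \1_S.
Proof.
move=> mS; suff: multiplier_set S by case.
by move: S mS; apply: smallest_sub;
  [exact: multiplier_set_sigma_algebra|exact: multiplier_open].
Qed.

(** The hypothesis says that the constant 1 satisfies [agree]. Multiplying by the multiplier [\1_S]
    keeps this, and the wave with zero frequency and phase yields equality on [\1_S]. *)
Theorem eq_functional_waves :
  (forall t theta, L (wave t theta) = L' (wave t theta)) ->
  forall F, bounded_measurable F -> L F = L' F.
Proof.
move=> LL'; apply: eq_bounded_functional => // S mS.
have a1 : agree (fun=> 1).
  split=> [|t theta]; first exact: bounded_measurable_cst.
  rewrite (_ : (fun x => _) = wave t theta)//.
  by apply/funext => x; rewrite mul1r.
have [_ /(_ 0 0)] := (multiplier_measurable mS).2 _ a1.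
rewrite (_ : (fun x => _) = \1_S)//.
by apply/funext => x; rewrite /wave /dotp trmx0 mul0mx mxE addr0 cos0 mulr1 mul1r.
Qed.

End multiplier.
End waves.

(** * Elementary trigonometric bounds and the Levy kernel *)

Section trig_inequalities.
Context {R : realType}.
Implicit Types y : R.

Lemma sqr_le_norm (a b : R) : `|a| <= `|b| -> a ^+ 2 <= b ^+ 2.
Proof.
by move=> ab; rewrite -(real_normK (num_real a)) -(real_normK (num_real b)) lerXn2r// nnegrE.
Qed.

Lemma norm_sin_le y : `|sin y| <= `|y|.
Proof.
have pos (z : R) : 0 <= z -> `|sin z| <= z.
  move=> z0.
  have [c _] : exists2 c, c \in `[0, z] & sin z - sin 0 = cos c * (z - 0).
    apply: MVT_segment => // x; apply: continuous_subspaceT => ?; exact: continuous_sin.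
  rewrite sin0 !subr0 => ->; rewrite normrM (ger0_norm z0) ler_piMl//.
  by rewrite ler_norml cos_geN1 cos_le1.
have [y0|y0] := leP 0 y; first by rewrite (ger0_norm y0) pos.
by rewrite -normrN -sinN -[leRHS]normrN (ger0_norm (_ : 0 <= - y)) ?pos//; lra.
Qed.

Lemma one_sub_cosE y : 1 - cos y = 2 * sin (y / 2) ^+ 2.
Proof.
have {1}-> : y = y / 2 + y / 2 by field.
by have := cos2Dsin2 (y / 2); rewrite cosD; lra.
Qed.

Lemma one_sub_cos_ge0 y : 0 <= 1 - cos y.
Proof. by rewrite subr_ge0 cos_le1. Qed.

Lemma one_sub_cos_le_sqr y : 1 - cos y <= y ^+ 2 / 2.
Proof.
rewrite one_sub_cosE.
have : sin (y / 2) ^+ 2 <= (y / 2) ^+ 2 by apply: sqr_le_norm; exact: norm_sin_le.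
by rewrite exprMn; lra.
Qed.

Lemma one_sub_cos_le_norm y : 1 - cos y <= `|y|.
Proof.
rewrite one_sub_cosE -(real_normK (num_real (sin _))) expr2.
have h := norm_sin_le (y / 2).
have h1 : `|sin (y / 2)| <= 1 by rewrite ler_norml sin_geN1 sin_le1.
have := ler_pM (normr_ge0 (sin (y / 2))) (normr_ge0 (sin (y / 2))) h h1.
by rewrite mulr1 normrM (ger0_norm (_ : 0 <= 2^-1 :> R)) ?invr_ge0//; lra.
Qed.

(** By the mean value theorem sin z - z = (cos c - 1) z with 0 <= c <= z, and 1 - cos c <= c. A
    quadratic bound is what second moments can absorb. *)
Lemma norm_sin_sub_le y : `|sin y - y| <= y ^+ 2.
Proof.
have pos (z : R) : 0 <= z -> `|sin z - z| <= z ^+ 2.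
  move=> z0.
  have [c cz] : exists2 c, c \in `[0, z] &
      (fun x => sin x - x) z - (fun x => sin x - x) 0 = (cos c - 1) * (z - 0).
    apply: (@MVT_segment _ (fun x => sin x - x) (fun x => cos x - 1)) => // x.
    by apply: continuous_subspaceT => ?; apply: cvgB; [exact: continuous_sin|exact: cvg_id].
  rewrite sin0 !subr0 => ->; rewrite normrM (ger0_norm z0) expr2; apply: ler_wpM2r => //.
  rewrite distrC ger0_norm ?one_sub_cos_ge0//; apply: le_trans (one_sub_cos_le_norm c) _.
  by move: cz; rewrite in_itv/= => /andP[c0 cz]; rewrite ger0_norm.
have [y0|y0] := leP 0 y; first exact: pos.
rewrite -normrN -sqrrN (_ : - (sin y - y) = sin (- y) - (- y)); first by apply: pos; lra.
by rewrite sinN; ring.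
Qed.

Lemma sin_ge_half y : 0 <= y -> y <= 2^-1 -> y / 2 <= sin y.
Proof.
move=> y0 y1; have := norm_sin_sub_le y; rewrite ler_norml => /andP[h _].
have : y ^+ 2 <= y / 2 by rewrite expr2 ler_wpM2l.
by lra.
Qed.

(** Since |y| / 2 <= 1/2, |sin (y / 2)| >= |y| / 4, and 1 - cos y = 2 sin^2 (y / 2) >= 2 y^2 /
    16. *)
Lemma one_sub_cos_ge y : `|y| <= 1 -> y ^+ 2 / 8 <= 1 - cos y.
Proof.
move=> y1; rewrite one_sub_cosE -(real_normK (num_real y)) -(real_normK (num_real (sin _)))
  !expr2.
have h : `|y| / 4 <= `|sin (y / 2)|.
  have -> : `|sin (y / 2)| = `|sin (`|y| / 2)|.
    by have [y0|y0] := leP 0 y; [rewrite (ger0_norm y0)|rewrite (ltr0_norm y0) mulNr sinN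
      normrN].
  apply: le_trans (ler_norm _); apply: le_trans (sin_ge_half _ _);
    have := normr_ge0 y; lra.
have h0 : 0 <= `|y| / 4 by rewrite divr_ge0.
have := ler_pM h0 h0 h h.
have -> : `|y| / 4 * (`|y| / 4) = `|y| * `|y| / 16 by field.
by lra.
Qed.

(* The real part of e^(i theta) (1 + i z - e^(i z)). *)
Definition levy_kernel (theta z : R) := cos theta - cos (z + theta) - z * sin theta.

Lemma levy_kernelE theta z :
  levy_kernel theta z = cos theta * (1 - cos z) + sin theta * (sin z - z).
Proof. by rewrite /levy_kernel cosD; ring. Qed.

Lemma levy_kernel0 theta : levy_kernel theta 0 = 0.
Proof. by rewrite levy_kernelE cos0 sin0; ring. Qed.

Lemma norm_levy_kernel_le theta z : `|levy_kernel theta z| <= 2 * z ^+ 2.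
Proof.
rewrite levy_kernelE (le_trans (ler_normD _ _))// !normrM.
have h1 : `|cos theta| * `|1 - cos z| <= 1 * (z ^+ 2 / 2).
  apply: ler_pM => //; first by rewrite ler_norml cos_geN1 cos_le1.
  by rewrite ger0_norm ?one_sub_cos_ge0// one_sub_cos_le_sqr.
have h2 : `|sin theta| * `|sin z - z| <= 1 * z ^+ 2.
  by apply: ler_pM => //; [rewrite ler_norml sin_geN1 sin_le1|exact: norm_sin_sub_le].
by have := sqr_ge0 z; lra.
Qed.

(** The part of the kernel affine in z cancels in the second difference; what remains is a wave
    times the nonnegative weight 2 (1 - cos b). *)
Lemma levy_kernel_second_difference theta (a b : R) :
  levy_kernel theta (a + b) + levy_kernel theta (a - b) - 2 * levy_kernel theta a =
  2 * (1 - cos b) * cos (a + theta).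
Proof. by rewrite /levy_kernel !cosD !sinD cosN sinN; ring. Qed.

End trig_inequalities.

(** * Integrability of real-valued functions *)

Section integrability.
Context {R : realType} {dT : measure_display} {T : measurableType dT}.
Variable mu : {measure set T -> \bar R}.
Implicit Types f g : T -> R.

Lemma dominated_integrable_real f g : measurable_fun setT f ->
  (forall x, `|f x| <= g x) -> mu.-integrable setT (EFin \o g) ->
  mu.-integrable setT (EFin \o f).
Proof.
move=> mf fg; apply: le_integrable => //; first exact/measurable_EFinP.
by move=> x _ /=; rewrite lee_fin (le_trans (fg x))// ler_norm.
Qed.

Lemma integrable_ge0_lty f : measurable_fun setT f -> (forall x, 0 <= f x) ->
  (\int[mu]_x (f x)%:E < +oo)%E -> mu.-integrable setT (EFin \o f).
Proof.
move=> mf f0 foo; apply/integrableP; split; first exact/measurable_EFinP.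
by under eq_integral do rewrite /= ger0_norm//.
Qed.

Lemma integrableZ_real (a : R) f : mu.-integrable setT (EFin \o f) ->
  mu.-integrable setT (EFin \o (fun x => a * f x)).
Proof. by move=> fi; apply: (integrableZl measurableT a fi). Qed.

Lemma Rintegral_sum (I : finType) (F : I -> T -> R) :
  (forall i, mu.-integrable setT (EFin \o F i)) ->
  \int[mu]_x (\sum_i F i x) = \sum_i \int[mu]_x F i x.
Proof.
move=> Fi; rewrite /Rintegral.
under eq_integral do rewrite -sumEFin.
rewrite integral_sum//.
by rewrite -sum_fine// => i _; apply: integrable_fin_num => //; exact: Fi.
Qed.

End integrability.

(** * Real and imaginary parts of the characteristic function, and second moments *)

Section characteristic_function.
Context {R : realType} {d : nat} {dT : measure_display} {T : measurableType dT}.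
Context {P : probability T R}.
Implicit Types (X : {RV P >-> borelRd R d}) (t : 'cV[R]_d).

Lemma cexp_iR (y : R) : cexp ('i%C * y%:C) = cos y +i* sin y.
Proof.
have -> : 'i%C * y%:C = 0 +i* y by simpc.
by rewrite /cexp /= expR0 mul1r.
Qed.

Lemma Re_cexp_le (z : R[i]) : complex.Re (cexp z) <= expR (complex.Re z).
Proof.
have -> : complex.Re (cexp z) = expR (complex.Re z) * cos (complex.Im z).
  by rewrite /cexp; simpc.
by rewrite ger_pMr ?expR_gt0// cos_le1.
Qed.

Lemma probability_integrable (F : T -> R) : bounded_measurable F ->
  P.-integrable setT (EFin \o F).
Proof.
move=> [mF [M FM]]; apply: (dominated_integrable_real (g := fun=> M)) => //.
exact: finite_measure_integrable_cst.
Qed.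

Lemma measurable_dotp_RV X t :
  measurable_fun setT (fun w => dotp t (X w : 'cV[R]_d)).
Proof. exact: measurableT_comp (measurable_dotp t) (measurable_funP X). Qed.

Lemma Re_charfun X t :
  complex.Re (charfun X t) = \int[P]_w cos (dotp t (X w : 'cV[R]_d)).
Proof.
transitivity (\int[P]_w complex.Re (cexp ('i%C * (dotp t (X w : 'cV[R]_d))%:C))) => //.
by apply: eq_Rintegral => w _; rewrite cexp_iR.
Qed.

Lemma Im_charfun X t :
  complex.Im (charfun X t) = \int[P]_w sin (dotp t (X w : 'cV[R]_d)).
Proof.
transitivity (\int[P]_w complex.Im (cexp ('i%C * (dotp t (X w : 'cV[R]_d))%:C))) => //.
by apply: eq_Rintegral => w _; rewrite cexp_iR.
Qed.

Lemma bounded_measurable_cosX X t :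
  bounded_measurable (fun w => cos (dotp t (X w : 'cV[R]_d))).
Proof.
split.
  apply: (@measurableT_comp _ _ _ _ _ _ (@cos R)); last exact: measurable_dotp_RV.
  by apply: continuous_measurable_fun; exact: continuous_cos.
by exists 1 => x; rewrite ler_norml cos_geN1 cos_le1.
Qed.

Lemma bounded_measurable_sinX X t :
  bounded_measurable (fun w => sin (dotp t (X w : 'cV[R]_d))).
Proof.
split.
  apply: (@measurableT_comp _ _ _ _ _ _ (@sin R)); last exact: measurable_dotp_RV.
  by apply: continuous_measurable_fun; exact: continuous_sin.
by exists 1 => x; rewrite ler_norml sin_geN1 sin_le1.
Qed.

Lemma integral_wave X t (theta : R) :
  \int[P]_w wave t theta (X w) =
  cos theta * complex.Re (charfun X t) - sin theta * complex.Im (charfun X t).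
Proof.
rewrite Re_charfun Im_charfun.
have bc := probability_integrable (bounded_measurable_cosX X t).
have bs := probability_integrable (bounded_measurable_sinX X t).
rewrite -(RintegralZl _ measurableT bc) -(RintegralZl _ measurableT bs).
rewrite -RintegralB//; [|exact: integrableZ_real|exact: integrableZ_real].
by apply: eq_Rintegral => w _; rewrite /wave cosD; ring.
Qed.

Lemma dotpxxE (x : 'cV[R]_d) : dotp x x = \sum_(i < d) x i 0 ^+ 2.
Proof. by rewrite dotpE; apply: eq_bigr => i _; rewrite expr2. Qed.

Lemma sqr_enorm (x : 'cV[R]_d) : enorm x ^+ 2 = dotp x x.
Proof. by rewrite sqr_sqrtr// dotpxxE; apply: sumr_ge0 => i _; exact: sqr_ge0. Qed.

Lemma norm_coord_le (x : 'cV[R]_d) i : `|x i 0| <= enorm x.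
Proof.
rewrite -(@ler_pXn2r _ 2)// ?nnegrE ?sqrtr_ge0// sqr_enorm dotpxxE (bigD1 i)//=.
by rewrite real_normK ?num_real// lerDl sumr_ge0// => j _; exact: sqr_ge0.
Qed.

(** A substitute for the Euclidean norm of t in Cauchy-Schwarz: any finite constant depending on t
    suffices below, and this one follows from the triangle inequality. *)
Definition l1norm t : R := \sum_(i < d) `|t i 0|.

Lemma norm_dotp_le t x : `|dotp t x| <= l1norm t * enorm x.
Proof.
rewrite dotpE /l1norm mulr_suml (le_trans (ler_norm_sum _ _ _))//.
by apply: ler_sum => i _; rewrite normrM ler_wpM2l// norm_coord_le.
Qed.

Lemma sqr_dotp_le t x : dotp t x ^+ 2 <= l1norm t ^+ 2 * enorm x ^+ 2.
Proof. by rewrite -exprMn; apply: sqr_le_norm;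
  rewrite (le_trans (norm_dotp_le _ _))// ler_norm. Qed.

Lemma measurable_sqr_enorm :
  measurable_fun setT (fun x : borelRd R d => enorm (x : 'cV[R]_d) ^+ 2).
Proof.
under eq_fun do rewrite sqr_enorm dotpxxE.
by apply: measurable_sum => i; apply: measurable_funX; exact: measurable_coord.
Qed.

Lemma second_moment_integrable X t : finite_second_moment X ->
  P.-integrable setT (EFin \o (fun w => dotp t (X w : 'cV[R]_d) ^+ 2)).
Proof.
rewrite /finite_second_moment unlock => X2.
apply: (@dominated_integrable_real _ _ _ _ _ (fun w =>
  l1norm t ^+ 2 * enorm (X w : 'cV[R]_d) ^+ 2)).
- by apply: measurable_funX; exact: measurable_dotp_RV.
- by move=> w; rewrite ger0_norm ?sqr_ge0// sqr_dotp_le.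
apply: integrableZ_real; apply: integrable_ge0_lty => //.
- exact: measurableT_comp measurable_sqr_enorm (measurable_funP X).
- by move=> w; exact: sqr_ge0.
Qed.

Lemma Re_charfun_ge X t : finite_second_moment X ->
  1 - (\int[P]_w (dotp t (X w : 'cV[R]_d) ^+ 2)) / 2 <= complex.Re (charfun X t).
Proof.
move=> X2; have i2 := second_moment_integrable t X2.
have i1 : P.-integrable setT (EFin \o (fun=> 1 : R)) by exact: finite_measure_integrable_cst.
have P1 : \int[P]_w (1 : R) = 1.
  by rewrite (Rintegral_cst P measurableT) mul1r; exact: (congr1 fine (probability_setT P)).
rewrite Re_charfun mulrC -[X in X - _ <= _]P1.
rewrite -(RintegralZl _ measurableT i2) -RintegralB//; last exact: integrableZ_real.
apply: le_Rintegral => //.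
- exact: (integrableB measurableT i1 (integrableZ_real _ i2)).
- exact/probability_integrable/bounded_measurable_cosX.
- by move=> w _; have := one_sub_cos_le_sqr (dotp t (X w : 'cV[R]_d)); lra.
Qed.

End characteristic_function.

(** * Integrals of 1 - cos <t, x> against a Levy measure *)

Section levy_moments.
Context {R : realType} {d : nat}.
Variable nu : {measure set (borelRd R d) -> \bar R}.
Implicit Types t x : 'cV[R]_d.

Lemma measurable_one_sub_cos t :
  measurable_fun setT (fun x : borelRd R d => 1 - cos (dotp t (x : 'cV[R]_d))).
Proof.
apply: measurable_funB => //.
apply: (@measurableT_comp _ _ _ _ _ _ (@cos R)); last exact: measurable_dotp.
by apply: continuous_measurable_fun; exact: continuous_cos.
Qed.

(** The 2 in the dominating constant handles |x| >= 1, where 1 - cos <= 2; the square of [l1norm t]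
    handles |x| < 1, where 1 - cos <= <t,x>^2 / 2. *)
Lemma integrable_one_sub_cos t : levy_measure nu ->
  nu.-integrable setT (EFin \o (fun x : borelRd R d => 1 - cos (dotp t (x : 'cV[R]_d)))).
Proof.
move=> [_ nu2].
pose m (x : borelRd R d) : R := Num.min 1 (enorm (x : 'cV[R]_d) ^+ 2).
apply: (@dominated_integrable_real _ _ _ _ _ (fun x : borelRd R d =>
  (2 + l1norm t ^+ 2) * m x)).
- exact: measurable_one_sub_cos.
- move=> x; rewrite ger0_norm ?one_sub_cos_ge0// /m.
  have c2 := one_sub_cos_le_sqr (dotp t (x : 'cV[R]_d)).
  have t2 := sqr_dotp_le t (x : 'cV[R]_d).
  have cN := cos_geN1 (dotp t (x : 'cV[R]_d)).
  have l2 := sqr_ge0 (l1norm t); have e2 := sqr_ge0 (enorm (x : 'cV[R]_d)).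
  have le2 := mulr_ge0 l2 e2.
  by have [h|h] := @leP _ R 1 (enorm (x : 'cV[R]_d) ^+ 2); rewrite ?mulrDl; lra.
apply: integrableZ_real; apply: integrable_ge0_lty => //.
- by apply: measurable_minr => //; exact: measurable_sqr_enorm.
- by move=> x; rewrite /m le_min ler01 sqr_ge0.
Qed.

(** The drift and the truncated compensator are purely imaginary, so they leave the real part. *)
Lemma Re_levy_exponent (b : 'cV[R]_d) (A : 'M[R]_d) t : levy_measure nu ->
  complex.Re (levy_exponent b A nu t) =
  - (quadf A t / 2) - \int[nu]_x (1 - cos (dotp t (x : 'cV[R]_d))).
Proof.
move=> lnu.
have reD (u v : R[i]) : complex.Re (u + v) = complex.Re u + complex.Re v by case: u; case: v.
have reN (u : R[i]) : complex.Re (- u) = - complex.Re u by case: u.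
have rei (y : R) : complex.Re ('i%C * y%:C) = 0 by simpc.
rewrite /levy_exponent !reD reN rei add0r; congr (_ + _).
transitivity (\int[nu]_x (-1 * (1 - cos (dotp t (x : 'cV[R]_d))))); last first.
  by rewrite (RintegralZl _ measurableT (integrable_one_sub_cos t lnu)) mulN1r.
apply: eq_Rintegral => x _.
by rewrite !reD !reN rei cexp_iR /=; ring.
Qed.

End levy_moments.

Lemma measurable_norm_dotp_le {R : realType} {d : nat} (t : 'cV[R]_d) (a : R) :
  measurable [set y : borelRd R d | `|dotp t (y : 'cV[R]_d)| <= a].
Proof.
rewrite (_ : [set y | _] = (fun y : borelRd R d => dotp t (y : 'cV[R]_d)) @^-1` `[- a, a]).
  by rewrite -[X in measurable X]setTI; exact: measurable_dotp.
by apply/seteqP; split => y /=; rewrite in_itv/= ler_norml.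
Qed.

(** * A second moment of X gives one of the Levy measure *)

Section levy_second_moment.
Context {R : realType} {d : nat} {dT : measure_display} {T : measurableType dT}.
Context {P : probability T R} (X : {RV P >-> borelRd R d}).
Variables (b : 'cV[R]_d) (A : 'M[R]_d) (nu : {measure set (borelRd R d) -> \bar R}).
Hypotheses (X2 : finite_second_moment X) (Xlevy : levy_triplet X b A nu).
Implicit Types t : 'cV[R]_d.

Let moment t := \int[P]_w (dotp t (X w : 'cV[R]_d) ^+ 2).

Lemma moment_ge0 t : 0 <= moment t.
Proof. by apply: Rintegral_ge0 => w _; exact: sqr_ge0. Qed.

Lemma moment_scale (s : R) t : moment (s *: t) = s ^+ 2 * moment t.
Proof.
rewrite /moment -(RintegralZl _ measurableT (second_moment_integrable t X2)).
by apply: eq_Rintegral => w _; rewrite dotpZl exprMn.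
Qed.

(* |phi(t)| <= exp (- int (1 - cos <t, x>) nu(dx)), while Re phi is at least
   1 - moment t / 2. *)
Lemma integral_one_sub_cos_le t : moment t <= 1 ->
  \int[nu]_x (1 - cos (dotp t (x : 'cV[R]_d))) <= moment t.
Proof.
move=> m1; have [psdA lnu phi] := Xlevy.
set J := \int[nu]_x _.
have J0 : 0 <= J by apply: Rintegral_ge0 => x _; exact: one_sub_cos_ge0.
have h1 := Re_charfun_ge t X2; rewrite -/(moment t) in h1.
have h2 := Re_cexp_le (levy_exponent b A nu t).
rewrite -phi (Re_levy_exponent b A t lnu) -/J in h2.
have h3 : expR (- (quadf A t / 2) - J) <= expR (- J).
  by rewrite ler_expR; have := psdA.2 t; lra.
have h4 := expR_ge1Dx J.
have h5 : expR (- J) * (1 + J) <= 1.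
  by have := ler_wpM2l (expR_ge0 (- J)) h4; rewrite [X in _ <= X]mulrC expRxMexpNx_1.
have h6 : (1 - moment t / 2) * (1 + J) <= 1.
  apply: le_trans h5; apply: ler_wpM2r; first lra.
  by apply: le_trans h1 _; apply: le_trans h2 h3.
have m0 := moment_ge0 t.
(* Write m for [moment t]. From [h6], J (1 - m / 2) <= m / 2; as m <= 1, the factor is at least 1/2,
   whence J <= m. *)
have : J * 2^-1 <= J * (1 - moment t / 2) by apply: ler_wpM2l => //; lra.
by lra.
Qed.

(** With u = t / (n + 1), the hypothesis reads [moment u <= 1]. Where |<t,x>| <= n + 1, one has
    |<u,x>| <= 1, hence <t,x>^2 <= 8 (n + 1)^2 (1 - cos <u,x>); the integral of the right side is at
    most 8 (n + 1)^2 [moment u] = 8 [moment t]. *)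
Lemma truncated_second_moment_le t (n : nat) : moment t <= n.+1%:R ^+ 2 ->
  (\int[nu]_x (dotp t (x : 'cV[R]_d) ^+ 2 * \1_[set y : borelRd R d | `|dotp t (y :
    'cV[R]_d)| <= n.+1%:R] x)%:E
   <= (8 * moment t)%:E)%E.
Proof.
move=> mn; have [_ lnu _] := Xlevy.
have n0 : 0 < n.+1%:R :> R by [].
pose u := n.+1%:R^-1 *: t.
have mu : moment u <= 1 by rewrite moment_scale exprVn mulrC ler_pdivrMr ?mul1r// exprn_gt0.
have iu := integrable_one_sub_cos u lnu.
have := integral_one_sub_cos_le mu; rewrite moment_scale exprVn => Ju.
have mS := measurable_norm_dotp_le t n.+1%:R.
apply: (@le_trans _ _ (\int[nu]_x (8 * n.+1%:R ^+ 2 * (1 - cos (dotp u (x : 'cV[R]_d))))%:E)%E).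
  apply: ge0_le_integral => //.
  - by move=> x _; rewrite lee_fin mulr_ge0 ?sqr_ge0.
  - apply/measurable_EFinP; apply: measurable_funM; last exact: measurable_indic.
    by apply: measurable_funX; exact: measurable_dotp.
  - by apply/measurable_EFinP; apply: measurable_funM => //; exact: measurable_one_sub_cos.
  move=> x _; rewrite lee_fin indicE; case: (boolP (x \in _)) => [|_]; last first.
    by rewrite mulr0 mulr_ge0 ?one_sub_cos_ge0// mulr_ge0// sqr_ge0.
  rewrite inE /= mulr1 => xn.
  have : `|dotp u (x : 'cV[R]_d)| <= 1.
    by rewrite dotpZl normrM ger0_norm ?invr_ge0// mulrC ler_pdivrMr// mul1r.
  move=> /one_sub_cos_ge; rewrite dotpZl exprMn exprVn => h.
  have n2 : 0 < n.+1%:R ^+ 2 :> R by rewrite exprn_gt0.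
  have := ler_wpM2l (ltW n2) h; rewrite !mulrA divff ?gt_eqF// mul1r; lra.
under eq_integral do rewrite EFinM.
rewrite integralZl// -[X in (_ * X)%E]fineK; last exact: integrable_fin_num.
rewrite -EFinM lee_fin -mulrA ler_pM2l// mulrC -ler_pdivlMr ?exprn_gt0//.
by rewrite mulrC.
Qed.

(** The truncated bound 8 [moment t] does not depend on n, so monotone convergence removes the
    truncation. *)
Lemma levy_second_moment t :
  nu.-integrable setT (EFin \o (fun x : borelRd R d => dotp t (x : 'cV[R]_d) ^+ 2)).
Proof.
apply: integrable_ge0_lty.
- by apply: measurable_funX; exact: measurable_dotp.
- by move=> x; exact: sqr_ge0.
pose g (n : nat) (x : borelRd R d) : \bar R :=
  (dotp t (x : 'cV[R]_d) ^+ 2 * \1_[set y : borelRd R d | `|dotp t (y : 'cV[R]_d)| <=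
    n.+1%:R] x)%:E.
have cg x : g n x @[n --> \oo] --> (dotp t (x : 'cV[R]_d) ^+ 2)%:E.
  apply: cvg_near_cst; near=> n.
  rewrite /g indicE mem_set ?mulr1//=.
  have : `|dotp t (x : 'cV[R]_d)| < n%:R by near: n; exact: nbhs_infty_gtr.
  by move=> /ltW/le_trans; apply; rewrite ler_nat.
have mg n : measurable_fun setT (g n).
  apply/measurable_EFinP; apply: measurable_funM.
    by apply: measurable_funX; exact: measurable_dotp.
  by apply: measurable_indic; exact: measurable_norm_dotp_le.
have g0 n x : (0 <= g n x)%E by rewrite lee_fin mulr_ge0 ?sqr_ge0.
have ndg x : nondecreasing_seq (g ^~ x).
  move=> i j ij; rewrite /g lee_fin ler_wpM2l ?sqr_ge0// !indicE ler_nat.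
  case: (boolP (x \in [set y | _ <= i.+1%:R])) => // /[!inE]/= xi.
  by rewrite mem_set//=; apply: le_trans xi _; rewrite ler_nat.
have := @cvg_monotone_convergence _ _ R nu _ measurableT g mg (fun n x _ =>
  g0 n x) (fun x _ => ndg x).
under [X in _ --> X]eq_integral do rewrite (cvg_lim _ (cg _))//.
move=> cvg_int; rewrite -(cvg_lim _ cvg_int)//.
apply: (@le_lt_trans _ _ (8 * moment t)%:E); last by rewrite ltry.
apply: lime_le; first by apply/cvg_ex; eexists; exact: cvg_int.
near=> n; apply: truncated_second_moment_le.
have : moment t < n%:R by near: n; exact: nbhs_infty_gtr.
move=> /ltW/le_trans; apply; rewrite -natrX ler_nat.
by rewrite expnS expn1 (leq_trans (leqnSn n))// leq_pmulr.
Unshelve. all: by end_near.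
Qed.

End levy_second_moment.

(** * Integrals against the density 2 (1 - b) on (0, 1) *)

Section triangular.
Context {R : realType}.

Let leb := @lebesgue_measure R.

Definition triangular (b : R) : R := 2 * (1 - b) * \1_(`]0, 1[) b.

Lemma integrable_continuous_indic (f : R -> R) : continuous f ->
  leb.-integrable setT (EFin \o (fun b => f b * \1_(`]0, 1[) b)).
Proof.
move=> cf.
have i01 : leb.-integrable `[0, 1] (EFin \o f).
  by apply: continuous_compact_integrable; [exact: segment_compact|exact: continuous_subspaceT].
have : leb.-integrable `]0, 1[ (EFin \o f).
  apply: integrableS i01 => //; exact: subset_itv_oo_cc.
move/integrable_mkcond => /(_ (measurable_itv _)).
by rewrite restrict_EFin patch_indic.
Qed.

Lemma integral_continuous_indic (f F : R -> R) : continuous f ->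
  (forall x : R, is_derive x 1 F (f x)) ->
  \int[leb]_b (f b * \1_(`]0, 1[) b) = F 1 - F 0.
Proof.
move=> cf dF.
have i01 : leb.-integrable `[0, 1] (EFin \o f).
  by apply: continuous_compact_integrable; [exact: segment_compact|exact: continuous_subspaceT].
have cF : continuous F.
  by move=> x; apply/differentiable_continuous; rewrite -derivable1_diffP;
    exact: (@ex_derive _ _ _ _ _ _ _ (dF x)).
transitivity (\int[leb]_(b in `]0, 1[) f b).
  rewrite [RHS]Rintegral_mkcond; apply: eq_Rintegral => x _.
  by rewrite patch_indic.
rewrite Rintegral_itv_bndo_bndc; last first.
  by apply: integrableS i01 => //; exact: subset_itv_oo_cc.
rewrite Rintegral_itv_obnd_cbnd; last first.
  by apply: integrableS i01 => //; exact: subset_itv_oc_cc.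
rewrite /Rintegral (@continuous_FTC2 _ f F)//.
- exact: continuous_subspaceT.
- split.
  + by move=> x _; exact: (@ex_derive _ _ _ _ _ _ _ (dF x)).
  + by apply: cvg_at_right_filter; exact: cF.
  + by apply: cvg_at_left_filter; exact: cF.
- by move=> x _; rewrite derive1E; exact: (@derive_val _ _ _ _ _ _ _ (dF x)).
Qed.

Lemma continuous_affine (a c : R) : continuous (fun b : R => a * b + c).
Proof.
by move=> b; apply: cvgD; [apply: cvgM; [exact: cvg_cst|exact: cvg_id]|exact: cvg_cst].
Qed.

Lemma is_derive_affine (a c x : R) : is_derive x 1 (fun b : R => a * b + c) a.
Proof.
have -> : (fun b : R => a * b + c) = (a \*: id) + cst c by apply/funext.
by apply: is_derive_eq; rewrite addr0 [_ *: _]mulr1.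
Qed.

Lemma integrable_triangular : leb.-integrable setT (EFin \o triangular).
Proof.
apply: integrable_continuous_indic => b.
apply: cvgM; first exact: cvg_cst.
by apply: cvgB; [exact: cvg_cst|exact: cvg_id].
Qed.

(** The real part of the identity for the integral of 2 (1 - b) e^(i b z), turned by the phase
    theta. The factor z^2 stays on the left so that z = 0 is included. *)
Lemma integral_cos_triangular (z theta : R) :
  z ^+ 2 * \int[leb]_b (cos (z * b + theta) * triangular b) = 2 * levy_kernel theta z.
Proof.
pose f b := cos (z * b + theta) * (2 * (1 - b)).
have cf : continuous f.
  move=> b; apply: cvgM.
    by apply: (@continuous_comp _ _ _ (fun b => z * b + theta) cos b);
      [exact: continuous_affine|exact: continuous_cos].
  by apply: cvgM; [exact: cvg_cst|apply: cvgB; [exact: cvg_cst|exact: cvg_id]].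
have fi := integrable_continuous_indic cf.
transitivity (\int[leb]_b (z ^+ 2 * f b * \1_(`]0, 1[) b)).
  rewrite -(RintegralZl _ measurableT); last first.
    by under eq_fun do rewrite mulrA; exact: fi.
  by apply: eq_Rintegral => b _; rewrite /f /triangular; ring.
(* An antiderivative of [z ^+ 2 * f], found by integration by parts. *)
pose F (b : R) := 2 * (1 - b) * z * sin (z * b + theta) - 2 * cos (z * b + theta).
have dF (x : R) : is_derive x 1 F (z ^+ 2 * f x).
  have dz := is_derive_affine z theta x.
  have ds := @is_derive1_comp R (@sin R) (fun b =>
    z * b + theta) x _ _ (is_derive_sin (z * x + theta)) dz.
  have dc := @is_derive1_comp R (@cos R) (fun b =>
    z * b + theta) x _ _ (is_derive_cos (z * x + theta)) dz.
  have dl := is_derive_affine (- (2 * z)) (2 * z) x.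
  have -> : F = (fun b => - (2 * z) * b + 2 * z) * (@sin R \o (fun b =>
    z * b + theta)) - (2 \*: (@cos R \o (fun b => z * b + theta))).
    apply/funext => b; rewrite /F.
    change (2 * (1 - b) * z * sin (z * b + theta) - 2 * cos (z * b + theta) =
      (- (2 * z) * b + 2 * z) * sin (z * b + theta) - 2 * cos (z * b + theta)).
    by move: (sin _) (cos _) => s c; ring.
  apply: is_derive_eq; rewrite /f.
  change ((- (2 * z) * x + 2 * z) * (cos (z * x + theta) * z) + sin (z * x +
    theta) * (- (2 * z)) - 2 * (- sin (z * x + theta) * z) =
    z ^+ 2 * (cos (z * x + theta) * (2 * (1 - x)))).
  by move: (sin _) (cos _) => s c; ring.
transitivity (F 1 - F 0).
  apply: (@integral_continuous_indic (fun b => z ^+ 2 * f b) F).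
  by move=> b; apply: cvgM; [exact: cvg_cst|exact: cf].
by rewrite /F /levy_kernel !mulr0 !mulr1 !add0r; ring.
Qed.

End triangular.

(** * Expectations as bounded functionals, and independence *)

Section product_functional.
Context {R : realType} {dU : measure_display} {U : measurableType dU}.
Variable Q : probability U R.

Lemma integrable1 : Q.-integrable setT (EFin \o (fun=> 1 : R)).
Proof. exact: finite_measure_integrable_cst. Qed.

Lemma expectation_functional {dT : measure_display} {T : measurableType dT}
    (Y : U -> T) (x0 : T) : measurable_fun setT Y ->
  bounded_functional (fun F : T -> R => \int[Q]_w F (Y w)).
Proof.
move=> mY.
have := weighted_functional 0 x0 mY integrable1.
rewrite (_ : (fun F : T -> R => _) = (fun F : T -> R => \int[Q]_w F (Y w)))//.
apply/funext => F; rewrite mul0r add0r.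
by apply: eq_Rintegral => w _; rewrite mulr1.
Qed.

Lemma integral_indic_preimage {dT : measure_display} {T : measurableType dT}
    (Y : U -> T) (S : set T) : measurable_fun setT Y -> measurable S ->
  \int[Q]_w \1_S (Y w) = fine (Q (Y @^-1` S)).
Proof.
move=> mY mS; rewrite /Rintegral.
have mYS : measurable (Y @^-1` S) by rewrite -[X in measurable X]setTI; exact: mY.
by rewrite (integral_indic Q measurableT mYS) setIT.
Qed.

(** Independence identifies the joint law with the product law on rectangles, hence everywhere, and
    Fubini integrates B out first. The first conclusion lets the inner integral serve as a test
    function for the law of Y. *)
Lemma independent2_integral (B Y : {RV Q >-> R}) (F : R * R -> R) :
  independent2 B Y -> bounded_measurable F ->
  bounded_measurable (fun y => \int[Q]_w F (B w, y)) /\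
  \int[Q]_w F (B w, Y w) = \int[Q]_w' \int[Q]_w F (B w, Y w').
Proof.
move=> ind bF.
pose PB := distribution Q B; pose PY := distribution Q Y.
have mBY : measurable_fun setT (fun w => (B w, Y w)).
  by apply/measurable_fun_pairP; split; exact: measurable_funP.
have mB : measurable_fun setT B by exact: measurable_funP.
have mY : measurable_fun setT Y by exact: measurable_funP.
pose Z : {RV Q >-> (R * R)%type} := mfun_Sub (mem_set mBY).
have PBY (S : set (R * R)) : measurable S -> (PB \x PY)%E S = Q ((fun w => (B w, Y w)) @^-1` S).
  have ZE (S1 S2 : set R) : measurable S1 -> measurable S2 ->
      distribution Q Z (S1 `*` S2) = (PB S1 * PY S2)%E by exact: ind.
  exact: (product_measure_unique ZE).
have P1 : (PB \x PY)%E.-integrable setT (EFin \o (fun=> 1 : R)).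
  apply: integrable_ge0_lty => //.
  have PT : (PB \x PY)%E setT = 1%E := etrans (PBY setT measurableT) (probability_setT Q).
  by rewrite integral_cst// mul1e [X in (X < _)%E](_ : _ = 1%E) ?ltry//; exact: PT.
have bL : bounded_functional (fun F : R * R -> R => \int[(PB \x PY)%E]_z F z).
  have b0 := @weighted_functional R _ (R * R)%type _ _ _ id (fun=> 1) 0 (0,
    0) (@measurable_id _ _ setT) P1.
  have -> : (fun F : R * R -> R => \int[(PB \x PY)%E]_z F z) =
      (fun F : R * R -> R => 0 * F (0, 0) + \int[(PB \x PY)%E]_z (F z * 1)); last exact: b0.
  by apply/funext => G; rewrite mul0r add0r; apply: eq_Rintegral => z _; rewrite mulr1.
have bL' := @expectation_functional _ (R * R)%type _ (0, 0) mBY.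
have LL' S : measurable S -> \int[(PB \x PY)%E]_z \1_S z = \int[Q]_w \1_S (B w, Y w).
  move=> mS; rewrite (integral_indic_preimage mBY mS) -PBY//.
  by rewrite /Rintegral integral_indic// setIT.
have intF (f : R -> R) (V : {RV Q >-> R}) : bounded_measurable f ->
    \int[distribution Q V]_x f x = \int[Q]_w f (V w).
  move=> [mf [M fM]]; rewrite /Rintegral integral_distribution//; first exact/measurable_EFinP.
  apply: probability_integrable; split; last by exists M => w; exact: fM.
  by apply: measurableT_comp mf _; exact: measurable_funP.
have [mF [M FM]] := bF.
have iF : (PB \x PY)%E.-integrable setT (EFin \o F).
  apply: (dominated_integrable_real (g := fun z => M * 1)) => //.
    by move=> z; rewrite mulr1.
  exact: integrableZ_real.
have secF y : bounded_measurable (fun b => F (b, y)).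
  by split; [exact: measurableT_comp mF (measurable_pair2 _)|exists M => b; exact: FM].
have secFB y : bounded_measurable (fun w => F (B w, y)).
  have [mf _] := secF y.
  by split; [exact: measurableT_comp mf mB|exists M => w; exact: FM].
have GE y : fubini_G PB (EFin \o F) y = (\int[Q]_w F (B w, y))%:E.
  rewrite -(intF (fun b => F (b, y)) B (secF y)) /Rintegral fineK//;
    apply: integrable_fin_num => //.
  exact: probability_integrable.
have mG : measurable_fun setT (fun y => \int[Q]_w F (B w, y)).
  apply/measurable_EFinP.
  rewrite (_ : EFin \o _ = fubini_G PB (EFin \o F)); first exact: (measurable_fubini_G iF).
  by apply/funext => y; rewrite GE.
have GM y : `|\int[Q]_w F (B w, y)| <= M.
  apply: le_trans (le_normr_Rintegral measurableT (probability_integrable (secFB y))) _.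
  apply: (@le_trans _ _ (\int[Q]_w M)).
    apply: le_Rintegral => //.
    - exact: (integrable_abse (probability_integrable (secFB y))).
    - exact: finite_measure_integrable_cst.
  rewrite Rintegral_cst//; have -> : fine (Q setT) =
    1 by exact: (congr1 fine (probability_setT Q)).
  by rewrite mulr1.
split; first by split=> //; exists M.
rewrite -(eq_bounded_functional bL bL' LL' bF).
rewrite -(intF _ Y (conj mG (ex_intro _ M GM))).
rewrite /Rintegral -integral21_prod_meas1//; congr fine.
by apply: eq_integral => y _; rewrite GE.
Qed.

End product_functional.

(** * Directional variance and the centered log-characteristic function *)

Section exponent.
Context {R : realType} {d : nat}.
Implicit Types (A : 'M[R]_d) (t h x u : 'cV[R]_d)
  (nu : {measure set (borelRd R d) -> \bar R}).

Definition finite_variance nu := forall t,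
  nu.-integrable setT (EFin \o (fun x : borelRd R d => dotp t (x : 'cV[R]_d) ^+ 2)).

Lemma dotp0l x : dotp 0 x = 0 :> R.
Proof. by rewrite /dotp trmx0 mul0mx mxE. Qed.

Lemma dotp0r t : dotp t 0 = 0 :> R.
Proof. by rewrite /dotp mulmx0 mxE. Qed.

Lemma quadfE A t : quadf A t = \sum_(i < d) \sum_(j < d) t i 0 * A i j * t j 0.
Proof.
rewrite /quadf mxE exchange_big /=; apply: eq_bigr => j _.
by rewrite mxE mulr_suml; apply: eq_bigr => i _; rewrite mxE.
Qed.

Lemma quadfDl A A' t : quadf (A + A') t = quadf A t + quadf A' t.
Proof. by rewrite /quadf mulmxDr mulmxDl mxE. Qed.

Lemma quadf0 A : quadf A 0 = 0.
Proof. by rewrite /quadf mulmx0 mxE. Qed.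

Lemma quadfZ A (s : R) t : quadf A (s *: t) = s ^+ 2 * quadf A t.
Proof.
rewrite !quadfE mulr_sumr; apply: eq_bigr => i _.
by rewrite mulr_sumr; apply: eq_bigr => j _; rewrite !mxE; ring.
Qed.

Lemma quadf_parallelogram A t h :
  quadf A (t + h) + quadf A (t - h) - 2 * quadf A t = 2 * quadf A h.
Proof.
rewrite !quadfE !mulr_sumr -big_split -sumrB; apply: eq_bigr => i _ /=.
rewrite !mulr_sumr -big_split -sumrB; apply: eq_bigr => j _ /=.
by rewrite !mxE; ring.
Qed.

(** Polarization: evaluation at e_i + e_j isolates twice the entry (i, j). *)
Lemma eq_quadf_mx A A' : A^T = A -> A'^T = A' ->
  (forall h, quadf A h = quadf A' h) -> A = A'.
Proof.
move=> As A's qAA'; apply/matrixP => i j.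
have pol (B : 'M[R]_d) : B^T = B -> quadf B (delta_mx i 0 + delta_mx j 0) =
    quadf B (delta_mx i 0) + quadf B (delta_mx j 0) + 2 * B i j.
  move=> Bs.
  have Bij (k l : 'I_d) : ((delta_mx k 0 : 'cV[R]_d)^T *m B *m delta_mx l (0 : 'I_1)) 0 0 =
    B k l.
    by rewrite trmx_delta -rowE -colE !mxE.
  have Bji : B j i = B i j by rewrite -{1}Bs mxE.
  have trD (x y : 'cV[R]_d) : (x + y)^T = x^T + y^T by rewrite raddfD.
  rewrite /quadf trD !mulmxDl !mulmxDr.
  have mxD (M N : 'M[R]_1) : (M + N) 0 0 = M 0 0 + N 0 0 by rewrite mxE.
  by rewrite !mxD !Bij Bji; ring.
have := qAA' (delta_mx i 0 + delta_mx j 0).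
by rewrite !pol// !qAA'; lra.
Qed.

Lemma integrable_coordM nu (i j : 'I_d) : finite_variance nu ->
  nu.-integrable setT (EFin \o (fun x : borelRd R d =>
    (x : 'cV[R]_d) i 0 * (x : 'cV[R]_d) j 0)).
Proof.
move=> nu2.
apply: (@dominated_integrable_real _ _ _ _ _ (fun x : borelRd R d =>
   dotp (delta_mx i 0) (x : 'cV[R]_d) ^+ 2 + dotp (delta_mx j 0) (x : 'cV[R]_d) ^+ 2)).
- by apply: measurable_funM; exact: measurable_coord.
- move=> x; rewrite !dotp_delta.
  move: ((x : 'cV[R]_d) i 0) ((x : 'cV[R]_d) j 0) => a b.
  have := sqr_ge0 (a + b); have := sqr_ge0 (a - b).
  have := sqr_ge0 a; have := sqr_ge0 b.
  by rewrite ler_norml => ? ? ? ?; apply/andP; split; lra.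
- exact: (integrableD measurableT (nu2 _) (nu2 _)).
Qed.

(** The covariance matrix is defined entrywise; integrability of x_i x_j, bounded by x_i^2 + x_j^2,
    allows the finite double sum under the integral. *)
Lemma dvarianceE A nu t : finite_variance nu ->
  dvariance A nu t = quadf A t + \int[nu]_x (dotp t (x : 'cV[R]_d) ^+ 2).
Proof.
move=> nu2; rewrite /dvariance /covariance_mx quadfDl; congr (_ + _).
have iF i j : nu.-integrable setT (EFin \o (fun x : borelRd R d =>
    t i 0 * t j 0 * ((x : 'cV[R]_d) i 0 * (x : 'cV[R]_d) j 0))).
  by apply: integrableZ_real; exact: integrable_coordM.
transitivity (\int[nu]_x (\sum_(i < d) \sum_(j < d)
    (t i 0 * t j 0 * ((x : 'cV[R]_d) i 0 * (x : 'cV[R]_d) j 0)))); last first.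
  apply: eq_Rintegral => x _; rewrite dotpE expr2 mulr_suml; apply: eq_bigr => i _.
  by rewrite mulr_sumr; apply: eq_bigr => j _; ring.
rewrite quadfE Rintegral_sum; last first.
  move=> i; have := integrable_sum measurableT (index_enum 'I_d) (P :=
    xpredT) (fun j _ => iF i j).
  by apply: eq_integrable => // x _; rewrite /= sumEFin.
apply: eq_bigr => i _; rewrite Rintegral_sum; last exact: iF.
apply: eq_bigr => j _; rewrite (RintegralZl _ measurableT (integrable_coordM i j nu2)) mxE.
by ring.
Qed.

Lemma integrable_levy_kernel nu theta t : finite_variance nu ->
  nu.-integrable setT (EFin \o (fun x : borelRd R d =>
    levy_kernel theta (dotp t (x : 'cV[R]_d)))).
Proof.
move=> nu2.
apply: (@dominated_integrable_real _ _ _ _ _ (fun x : borelRd R d =>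
  2 * dotp t (x : 'cV[R]_d) ^+ 2)).
- apply: measurable_funB; last by apply: measurable_funM => //; exact: measurable_dotp.
  by apply: measurable_funB => //; exact: (bounded_measurable_wave t theta).1.
- by move=> x; exact: norm_levy_kernel_le.
- exact/integrableZ_real/nu2.
Qed.

(* - Re (e^(i theta) psi(t)), where psi is the log-characteristic function of the
   centered law with Gaussian covariance A and Levy measure nu. *)
Definition log_exponent A nu (theta : R) t : R :=
  cos theta * quadf A t / 2 + \int[nu]_x levy_kernel theta (dotp t (x : 'cV[R]_d)).

(** Integration of [F] against h^T A h delta_0 + 2 (1 - cos <h,x>) nu(dx). The difference in the
    name is that of [log_exponent] with step h, not one of [F]. *)
Definition second_difference A nu h (F : borelRd R d -> R) : R :=
  quadf A h * F (0 : 'cV[R]_d) +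
  \int[nu]_x (F x * (2 * (1 - cos (dotp h (x : 'cV[R]_d))))).

Lemma integrable_weight nu h : finite_variance nu ->
  nu.-integrable setT (EFin \o (fun x : borelRd R d => 2 * (1 - cos (dotp h (x : 'cV[R]_d))))).
Proof.
move=> nu2.
apply: (@dominated_integrable_real _ _ _ _ _ (fun x : borelRd R d =>
  dotp h (x : 'cV[R]_d) ^+ 2)).
- by apply: measurable_funM => //; exact: measurable_one_sub_cos.
- move=> x; rewrite ger0_norm ?mulr_ge0 ?one_sub_cos_ge0//.
  by have := one_sub_cos_le_sqr (dotp h (x : 'cV[R]_d)); lra.
- exact: nu2.
Qed.

Lemma second_difference_functional A nu h : finite_variance nu ->
  bounded_functional (second_difference A nu h).
Proof. by move=> nu2; apply: weighted_functional => //; exact: integrable_weight. Qed.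

(** The Gaussian part is the parallelogram identity; the jump part is the second difference of the
    kernel, integrated. *)
Lemma second_difference_wave A nu h t theta : finite_variance nu ->
  second_difference A nu h (wave t theta) =
  log_exponent A nu theta (t + h) + log_exponent A nu theta (t - h)
  - 2 * log_exponent A nu theta t.
Proof.
move=> nu2; rewrite /second_difference /log_exponent.
have -> : wave t theta (0 : 'cV[R]_d) = cos theta by rewrite /wave dotp0r add0r.
have ik s := integrable_levy_kernel theta s nu2.
have -> : \int[nu]_x (wave t theta x * (2 * (1 - cos (dotp h (x : 'cV[R]_d))))) =
    \int[nu]_x levy_kernel theta (dotp (t + h) (x : 'cV[R]_d)) +
    \int[nu]_x levy_kernel theta (dotp (t - h) (x : 'cV[R]_d)) -
    2 * \int[nu]_x levy_kernel theta (dotp t (x : 'cV[R]_d)).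
  rewrite -(RintegralZl _ measurableT (ik t)) -RintegralD// -RintegralB//; last first.
  - exact: integrableZ_real.
  - exact: (integrableD measurableT (ik _) (ik _)).
  apply: eq_Rintegral => x _; rewrite !dotpDl dotpNl levy_kernel_second_difference /wave.
  by ring.
have := quadf_parallelogram A t h.
move: (quadf A (t + h)) (quadf A (t - h)) (quadf A t) (quadf A h) => a b c e abce.
have -> : e = (a + b - 2 * c) / 2 by lra.
by field.
Qed.

(** * The law of the remainder determines the exponent along its direction *)

Section remainder.
Variables (A : 'M[R]_d) (nu : {measure set (borelRd R d) -> \bar R}).
Variables (u : 'cV[R]_d) (rho : probability R R).
Hypotheses (nu2 : finite_variance nu) (V_gt0 : 0 < dvariance A nu u)
  (rhoP : remainder_law A nu u rho).

(** The law [rho] is replaced by that of B Y, B is integrated out by independence, and the law of Y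
    is written as its atom plus its density against nu. The factor <u,x>^2 of that density turns the
    B-integral into the kernel. *)
Lemma remainder_integral (theta s : R) :
  s ^+ 2 * (dvariance A nu u * \int[rho]_r cos (s * r + theta)) =
  2 * log_exponent A nu theta (s *: u).
Proof.
have [dW [W [Q [Y [B [lawY lawB ind lawR]]]]]] := rhoP.
have : dvariance A nu u != 0 by rewrite gt_eqF.
set V := dvariance A nu u in lawY * => V0.
have mY : measurable_fun setT Y by exact: measurable_funP.
have mB : measurable_fun setT B by exact: measurable_funP.
have mBY : measurable_fun setT (fun w => B w * Y w) by exact: measurable_funM.
have mcos : measurable_fun setT (@cos R) by apply: continuous_measurable_fun;
  exact: continuous_cos.
have maff : measurable_fun setT (fun r : R => s * r + theta).
  by apply: continuous_measurable_fun; exact: continuous_affine.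
have bf : bounded_measurable (fun r : R => cos (s * r + theta)).
  split; first exact: measurableT_comp mcos maff.
  by exists 1 => x; rewrite ler_norml cos_geN1 cos_le1.
have step1 : \int[rho]_r cos (s * r + theta) = \int[Q]_w cos (s * (B w * Y w) + theta).
  have bL := expectation_functional rho (0 : R) (@measurable_id _ _ setT).
  have bL' := expectation_functional Q (0 : R) mBY.
  apply: (eq_bounded_functional bL bL' _ bf) => S mS.
  rewrite (integral_indic_preimage Q mBY mS).
  rewrite (integral_indic_preimage rho (@measurable_id _ _ setT) mS).
  by congr fine; exact: lawR.
pose F (p : R * R) := cos (s * (p.1 * p.2) + theta).
have bF : bounded_measurable F.
  split; last by exists 1 => x; rewrite ler_norml cos_geN1 cos_le1.
  apply: (measurableT_comp mcos); apply: (measurableT_comp maff).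
  by apply: measurable_funM; [exact: measurable_fst|exact: measurable_snd].
have [bg step2] := independent2_integral ind bF.
pose g y := \int[Q]_w F (B w, y).
(* Here g(y) is the expectation of cos (s B y + theta), computed with the triangular density. *)
have gE y : (s * y) ^+ 2 * g y = 2 * levy_kernel theta (s * y).
  rewrite -integral_cos_triangular; congr (_ * _).
  transitivity (\int[lebesgue_measure]_b (F (b, y) * triangular b)); last first.
    by apply: eq_Rintegral => b _; rewrite /F /=; congr (cos _ * _); ring.
  have bL := expectation_functional Q (0 : R) mB.
  (* [lebesgue_measure] lives on [measurableTypeR R]; the identity carries its sigma-algebra to that
     of [R]. *)
  have mid : @measurable_fun _ _ (measurableTypeR R) R setT id.
    by move=> _ S mS; rewrite setTI; exact: mS.
  have bL' := weighted_functional 0 (0 : R) mid (@integrable_triangular R).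
  have bFy : bounded_measurable (fun b => F (b, y)).
    split; last by exists 1 => x; rewrite ler_norml cos_geN1 cos_le1.
    exact: measurableT_comp bF.1 (measurable_pair2 _).
  have := eq_bounded_functional bL bL' _ bFy; rewrite mul0r add0r; apply => S mS.
  rewrite (integral_indic_preimage Q mB mS) mul0r add0r.
  have -> : Q (B @^-1` S) = distribution Q B S by [].
  rewrite lawB// -[LHS]/(\int[lebesgue_measure]_(b in S) triangular b).
  rewrite Rintegral_mkcond; apply: eq_Rintegral => b _.
  by rewrite patch_indic /= mulrC.
(* [gE] is vacuous at y = 0, yet the Gaussian atom of the law of Y sees exactly this value. *)
have g0 : g 0 = cos theta.
  rewrite /g; transitivity (\int[Q]_w (cos theta)).
    by apply: eq_Rintegral => w _; rewrite /F /= !mulr0 add0r.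
  rewrite Rintegral_cst//; have -> : fine (Q setT) =
    1 by exact: (congr1 fine (probability_setT Q)).
  by rewrite mulr1.
have iu := nu2 u.
have iuV := integrableZ_real V^-1 iu.
have step3 : \int[Q]_w g (Y w) = V^-1 * quadf A u * g 0 +
    \int[nu]_x (g (dotp u (x : 'cV[R]_d)) * (V^-1 * dotp u (x : 'cV[R]_d) ^+ 2)).
  have bL := expectation_functional Q (0 : R) mY.
  have bL' := weighted_functional (V^-1 * quadf A u) (0 : R) (measurable_dotp u) iuV.
  apply: (eq_bounded_functional bL bL' _ bg) => S mS.
  rewrite (integral_indic_preimage Q mY mS).
  have -> : Q (Y @^-1` S) = distribution Q Y S by [].
  rewrite lawY// /dmeasure.
  have iS : nu.-integrable setT (EFin \o (fun x : borelRd R d =>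
    \1_S (dotp u (x : 'cV[R]_d)) * dotp u (x : 'cV[R]_d) ^+ 2)).
    apply: dominated_integrable_real iu.
      apply: measurable_funM; first by apply: measurableT_comp (measurable_dotp u);
        exact: measurable_indic.
      by apply: measurable_funX; exact: measurable_dotp.
    move=> x; rewrite normrM (ger0_norm (sqr_ge0 _)) ler_piMl ?sqr_ge0// indicE.
    by case: (_ \in _); rewrite ?normr1 ?normr0.
  have -> : (\int[nu]_x (\1_S (dotp u (x : 'cV[R]_d)) * dotp u (x : 'cV[R]_d) ^+ 2)%:E)%E =
      (\int[nu]_x (\1_S (dotp u (x : 'cV[R]_d)) * dotp u (x : 'cV[R]_d) ^+ 2))%:E.
    by rewrite /Rintegral fineK//; exact: integrable_fin_num.
  rewrite diracE.
  transitivity (V^-1 * (quadf A u * \1_S (0 : R) +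
    \int[nu]_x (\1_S (dotp u (x : 'cV[R]_d)) * dotp u (x : 'cV[R]_d) ^+ 2))); first by [].
  rewrite mulrDr mulrA; congr (_ + _).
  rewrite -(RintegralZl _ measurableT iS).
  by apply: eq_Rintegral => x _; rewrite mulrCA.
have -> : \int[rho]_r cos (s * r + theta) = V^-1 * quadf A u * cos theta +
    V^-1 * \int[nu]_x (g (dotp u (x : 'cV[R]_d)) * dotp u (x : 'cV[R]_d) ^+ 2).
  rewrite step1 (step2 : _ = \int[Q]_w g (Y w)) step3 g0; congr (_ + _).
  have [mg [M gM]] := bg.
  rewrite -RintegralZl//; first by apply: eq_Rintegral => x _; rewrite mulrCA.
  apply: (@dominated_integrable_real _ _ _ _ _ (fun x : borelRd R d =>
    M * dotp u (x : 'cV[R]_d) ^+ 2)).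
  - apply: measurable_funM; first exact: measurableT_comp mg (measurable_dotp u).
    by apply: measurable_funX; exact: measurable_dotp.
  - by move=> x; rewrite normrM (ger0_norm (sqr_ge0 _)) ler_wpM2r ?sqr_ge0//; exact: gM.
  - exact: integrableZ_real.
set I := \int[nu]_x (g _ * _).
have IE : s ^+ 2 * I = 2 * \int[nu]_x levy_kernel theta (dotp (s *: u) (x : 'cV[R]_d)).
  (* For s = 0 both sides vanish; otherwise [gE] can be divided by s^2. *)
  have [s0|s0] := eqVneq s 0.
    rewrite s0 expr0n mul0r [X in 2 * X](_ : _ = 0) ?mulr0//.
    rewrite /Rintegral integral0_eq// => x _.
    by rewrite scale0r dotp0l levy_kernel0.
  rewrite -(RintegralZl _ measurableT (integrable_levy_kernel theta (s *: u) nu2)).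
  have -> : I = \int[nu]_x ((s ^+ 2)^-1 * (2 * levy_kernel theta (dotp (s *: u) (x :
    'cV[R]_d)))).
    apply: eq_Rintegral => x _; rewrite dotpZl -gE exprMn.
    by rewrite -mulrA (mulKf (expf_neq0 2 s0)) mulrC.
  have ii := integrableZ_real 2 (integrable_levy_kernel theta (s *: u) nu2).
  by rewrite (RintegralZl _ measurableT ii) mulrA divff ?mul1r// expf_neq0.
transitivity (s ^+ 2 * (quadf A u * cos theta) + s ^+ 2 * I); first by field.
by rewrite IE /log_exponent quadfZ; field.
Qed.

End remainder.

(** Zero variance kills both nonnegative summands, u^T A u and the integral of <u,x>^2; the kernel
    is bounded by 2 s^2 <u,x>^2. *)
Lemma log_exponent_null A nu theta u : finite_variance nu -> psd A ->
  dvariance A nu u = 0 -> forall s, log_exponent A nu theta (s *: u) = 0.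
Proof.
move=> nu2 [_ psdA] V0 s.
have i0 : 0 <= \int[nu]_x (dotp u (x : 'cV[R]_d) ^+ 2).
  by apply: Rintegral_ge0 => x _; exact: sqr_ge0.
move: V0; rewrite dvarianceE// => V0.
have A0 : quadf A u = 0 by have := psdA u; lra.
have {i0} I0 : \int[nu]_x (dotp u (x : 'cV[R]_d) ^+ 2) = 0 by lra.
rewrite /log_exponent quadfZ A0 !mulr0 mul0r add0r.
apply/eqP; rewrite -normr_le0.
have ik := integrable_levy_kernel theta (s *: u) nu2.
apply: le_trans (le_normr_Rintegral measurableT ik) _.
rewrite -(mulr0 (2 * s ^+ 2)) -I0 -(RintegralZl _ measurableT (nu2 u)).
apply: le_Rintegral => //.
- exact: (integrable_abse ik).
- exact: integrableZ_real.
- by move=> x _; have := norm_levy_kernel_le theta (dotp (s *: u) (x : 'cV[R]_d));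
    rewrite dotpZl exprMn mulrA.
Qed.

Lemma enorm_gt0 t : t != 0 -> 0 < enorm t.
Proof.
move=> t0; rewrite lt_neqAle sqrtr_ge0 andbT; apply: contra_neq t0 => n0.
apply/matrixP => i j; rewrite (ord1 j) mxE.
by apply/eqP; rewrite -normr_le0 (le_trans (norm_coord_le _ _))// -n0.
Qed.

Lemma enormZ (s : R) t : 0 <= s -> enorm (s *: t) = s * enorm t.
Proof.
move=> s0; rewrite /enorm dotpZl {1}/dotp -scalemxAr mxE -/(dotp t t) mulrA -expr2.
by rewrite sqrtrM ?sqr_ge0// sqrtr_sqr ger0_norm.
Qed.

Lemma direction_decomposition t : t != 0 -> exists s u, enorm u = 1 /\ t = s *: u.
Proof.
move=> t0; have n0 := enorm_gt0 t0; exists (enorm t), ((enorm t)^-1 *: t).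
rewrite enormZ ?invr_ge0 ?(ltW n0)// mulVf ?gt_eqF//; split=> //.
by rewrite scalerA divff ?gt_eqF// scale1r.
Qed.

End exponent.

(** * Recovery of the Gaussian covariance and of the Levy measure *)

Section identification.
Context {R : realType} {d : nat}.
Implicit Types (h t x : 'cV[R]_d).

(** The cover is made disjoint by [seqDU], and countable additivity sums the pieces. *)
Lemma measure_countable_cover {dT : measure_display} {T : measurableType dT}
    (mu mu' : {measure set T -> \bar R}) (V : nat -> set T) :
  (forall k, measurable (V k)) ->
  (forall k S, measurable S -> S `<=` V k -> mu S = mu' S) ->
  forall S, measurable S -> S `<=` \bigcup_k V k -> mu S = mu' S.
Proof.
move=> mV eV S mS SV.
have mD k : measurable (S `&` seqDU V k).
  apply: measurableI => //; apply: measurableD => //.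
  exact: bigsetU_measurable.
have tD : trivIset setT (fun k => S `&` seqDU V k).
  by apply: trivIset_setIl; exact: trivIset_seqDU.
have -> : S = \bigcup_k (S `&` seqDU V k).
  by rewrite -setI_bigcupr -seqDU_bigcup_eq; apply/esym/setIidPl.
have mU : measurable (\bigcup_k (S `&` seqDU V k)) by exact: bigcup_measurable.
rewrite !measure_semi_bigcup//; apply: eq_eseriesr => k _.
by apply: (eV k) => // x [_ []].
Qed.

Lemma measurable_set0 : measurable ([set (0 : 'cV[R]_d)] : set (borelRd R d)).
Proof.
have -> : [set (0 : 'cV[R]_d)] =
    (fun x : borelRd R d => enorm (x : 'cV[R]_d) ^+ 2) @^-1` [set 0].
  apply/seteqP; split => x /=.
    by move=> ->; rewrite sqr_enorm dotp0l.
  move=> x0; apply: contrapT => /eqP /enorm_gt0 n0.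
  by have := exprn_gt0 2 n0; rewrite x0 ltxx.
rewrite -[X in measurable X]setTI; apply: measurable_sqr_enorm => //.
Qed.

(** A nonzero coordinate x_i and an integer n > |x_i| give the direction e_i / n, for which 0 <
    |<c,x>| <= 1. Countably many weights 1 - cos <c,x> thus suffice to see every nonzero x. *)
Lemma rational_direction x : x != 0 ->
  exists c : 'cV[rat]_d, 0 < 1 - cos (dotp (map_mx ratr c : 'cV[R]_d) x).
Proof.
move=> x0.
have [i xi0] : exists i, x i 0 != 0.
  apply: contrapT => /forallNP x00; move/eqP: x0; apply.
  by apply/matrixP => i j; rewrite (ord1 j) mxE; apply/eqP; move: (x00 i) => /negP;
    rewrite negbK.
pose n := (Num.truncn `|x i 0|).+1.
have xn : `|x i 0| < n%:R by rewrite /n truncnS_gt.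
have n0 : 0 < n%:R :> R by rewrite ltr0n.
exists (n%:R^-1 *: delta_mx i 0).
rewrite map_mxZ map_delta_mx fmorphV /= ratr_nat dotpZl dotp_delta.
set y := n%:R^-1 * x i 0.
have y1 : `|y| <= 1.
  by rewrite normrM ger0_norm ?invr_ge0 ?ler0n// mulrC ler_pdivrMr// mul1r ltW.
apply: lt_le_trans (one_sub_cos_ge y1); rewrite divr_gt0// exprn_even_gt0//=.
by rewrite mulf_neq0// invr_neq0// gt_eqF.
Qed.

Variables nu nu' : {measure set (borelRd R d) -> \bar R}.
Hypotheses (nu2 : finite_variance nu) (nu2' : finite_variance nu').

Lemma weighted_measure_finite (mu : {measure set (borelRd R d) -> \bar R}) h (r : R)
    (S : set (borelRd R d)) : finite_variance mu -> 0 < r -> measurable S ->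
  (forall x, S x -> r < 1 - cos (dotp h (x : 'cV[R]_d))) ->
  mu.-integrable setT (EFin \o \1_S).
Proof.
move=> mu2 r0 mS Sr.
apply: (@dominated_integrable_real _ _ _ _ _ (fun x : borelRd R d =>
  r^-1 * (2 * (1 - cos (dotp h (x : 'cV[R]_d)))))).
- exact: measurable_indic.
- move=> x; rewrite indicE; case: (boolP (x \in S)) => [|_].
    rewrite inE => /Sr rx; rewrite normr1 -ler_pdivrMl ?invr_gt0// invrK mulr1.
    by lra.
  by rewrite normr0 mulr_ge0 ?invr_ge0 ?(ltW r0)// mulr_ge0 ?one_sub_cos_ge0.
- by apply: integrableZ_real; exact: integrable_weight.
Qed.

(** On [S] the weight stays above r > 0, so [\1_S] divided by it is a bounded test function, and
    integrating it recovers the measure of [S]. *)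
Lemma eq_weighted_measure h (r : R) (S : set (borelRd R d)) :
  (forall F, bounded_measurable F ->
    \int[nu]_x (F x * (2 * (1 - cos (dotp h (x : 'cV[R]_d))))) =
    \int[nu']_x (F x * (2 * (1 - cos (dotp h (x : 'cV[R]_d)))))) ->
  0 < r -> measurable S ->
  (forall x, S x -> r < 1 - cos (dotp h (x : 'cV[R]_d))) -> nu S = nu' S.
Proof.
move=> eF r0 mS Sr.
have iS := weighted_measure_finite nu2 r0 mS Sr.
have iS' := weighted_measure_finite nu2' r0 mS Sr.
(* Continuous on R, and equal to 1 / w for w > r. *)
pose q (w : R) := (`|w - r| + r)^-1.
have q0 w : 0 < `|w - r| + r by have := normr_ge0 (w - r); lra.
have cq : continuous q.
  move=> w; apply: cvgV; first by rewrite gt_eqF.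
  by apply: cvgD; [apply: cvg_norm; apply: cvgB; [exact: cvg_id|exact: cvg_cst]|exact: cvg_cst].
pose F (x : borelRd R d) := \1_S x * q (1 - cos (dotp h (x : 'cV[R]_d))).
have bF : bounded_measurable F.
  apply: bounded_measurableM; first exact: bounded_measurable_indic.
  split.
    apply: (@measurableT_comp _ _ _ _ _ _ q); last exact: measurable_one_sub_cos.
    exact: continuous_measurable_fun.
  exists r^-1 => x; rewrite ger0_norm ?invr_ge0 ?(ltW (q0 _))//.
  by rewrite lef_pV2 ?posrE//; have := normr_ge0 (1 - cos (dotp h (x : 'cV[R]_d)) - r); lra.
have FE x : F x * (2 * (1 - cos (dotp h (x : 'cV[R]_d)))) = 2 * \1_S x.
  rewrite /F indicE; case: (boolP (x \in S)) => [|_]; last by rewrite !mul0r mulr0.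
  rewrite inE => /Sr rx; rewrite mul1r /q ger0_norm; last by lra.
  have w0 : 1 - cos (dotp h (x : 'cV[R]_d)) != 0 by rewrite gt_eqF// (lt_trans r0).
  by rewrite subrK mulrCA mulVf.
have := eF F bF.
have RE (mu : {measure set (borelRd R d) -> \bar R}) :
    \int[mu]_x (F x * (2 * (1 - cos (dotp h (x : 'cV[R]_d))))) = \int[mu]_x (2 * \1_S x).
  by apply: eq_Rintegral => x _; exact: FE.
rewrite !RE.
rewrite (RintegralZl _ measurableT iS) (RintegralZl _ measurableT iS').
have two0 : (2 : R) != 0 by rewrite pnatr_eq0.
move=> /(mulfI two0).
(* The equality is only between [fine] values; finiteness of both integrals lifts it to the extended
   reals. *)
rewrite /Rintegral => e.
have fS := integrable_fin_num measurableT iS.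
have fS' := integrable_fin_num measurableT iS'.
have : (\int[nu]_x (\1_S x)%:E = \int[nu']_x (\1_S x)%:E)%E.
  by rewrite -(fineK fS) -(fineK fS') e.
by rewrite !integral_indic// !setIT.
Qed.

(** Both measures vanish at the origin. Its complement is covered by the countably many sets where 1
    - cos <c,x> exceeds a positive rational r, with c rational, and on each of them the measures
    agree. *)
Lemma eq_levy_measure :
  levy_measure nu -> levy_measure nu' ->
  (forall h F, bounded_measurable F ->
    \int[nu]_x (F x * (2 * (1 - cos (dotp h (x : 'cV[R]_d))))) =
    \int[nu']_x (F x * (2 * (1 - cos (dotp h (x : 'cV[R]_d)))))) ->
  forall S, measurable S -> nu S = nu' S.
Proof.
move=> [nu0 _] [nu0' _] eF S mS.
pose V k : set (borelRd R d) := if unpickle k is Some (c, r) then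
    [set x : borelRd R d | (0 : R) < ratr r < 1 - cos (dotp (map_mx ratr (c : 'cV[rat]_d) :
      'cV[R]_d) (x : 'cV[R]_d))]
  else set0.
have mV k : measurable (V k).
  rewrite /V; case: unpickle => [[c r]|//].
  rewrite (_ : [set _ | _] = if 0 < ratr r :> R then
    (fun x : borelRd R d => 1 - cos (dotp (map_mx ratr c : 'cV[R]_d) (x : 'cV[R]_d))) @^-1`
      `]ratr r, +oo[ else set0).
    case: ifP => // _; rewrite -[X in measurable X]setTI.
    exact: measurable_one_sub_cos.
  by apply/seteqP; split => x /=; case: ifP => //= _; rewrite ?in_itv/= ?andbT.
have mS0 : measurable (S `\ (0 : 'cV[R]_d)) by apply: measurableD => //; exact: measurable_set0.
have SE (mu : {measure set (borelRd R d) -> \bar R}) : mu [set (0 : 'cV[R]_d)] = 0%E ->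
  mu S = mu (S `\ (0 : 'cV[R]_d)).
  move=> mu0; rewrite (measureDI mu mS measurable_set0) [X in (_ + X)%E](_ : _ = 0%E) ?adde0//.
  by apply: (subset_measure0 _ measurable_set0) => //; apply: measurableI => //;
    exact: measurable_set0.
rewrite (SE nu)// (SE nu')//.
apply: (measure_countable_cover mV) => // [k S' mS' S'V|x [_ /eqP x0]].
  move: S'V; rewrite /V; case: unpickle => [[c r]|]; last first.
    by rewrite subset0 => ->; rewrite !measure0.
  have [r0|r0] := ltP 0 (ratr r : R); last first.
    move=> S'V; suff -> : S' = set0 by rewrite !measure0.
    by rewrite -subset0 => x /S'V.
  move=> S'V; apply: (eq_weighted_measure (eF (map_mx ratr c)) r0 mS') => x Sx.
  by have /andP[] := S'V x Sx.
have [c cx] := rational_direction x0.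
have [r] := rat_in_itvoo cx.
by rewrite in_itv/= => rx; exists (pickle (c, r)) => //; rewrite /V pickleK.
Qed.

Variables A A' : 'M[R]_d.
Hypothesis eq_exp : forall theta t,
  log_exponent A nu theta t = log_exponent A' nu' theta t.

Lemma eq_second_difference h F : bounded_measurable F ->
  second_difference A nu h F = second_difference A' nu' h F.
Proof.
apply: eq_functional_waves.
- exact: second_difference_functional.
- exact: second_difference_functional.
by move=> t theta; rewrite !second_difference_wave// !eq_exp.
Qed.

(** Tested on the indicator of the origin, where 1 - cos <h,x> is 0, the second difference keeps
    only its atom. *)
Lemma eq_quadf h : quadf A h = quadf A' h.
Proof.
have := eq_second_difference h (bounded_measurable_indic measurable_set0).
have z (mu : {measure set (borelRd R d) -> \bar R}) :
   \int[mu]_x (\1_[set (0 : 'cV[R]_d)] x * (2 * (1 - cos (dotp h (x : 'cV[R]_d))))) = 0.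
  rewrite /Rintegral integral0_eq// => x _; rewrite indicE.
  case: (boolP (x \in _)) => [|_]; last by rewrite mul0r.
  by rewrite inE => ->; rewrite dotp0r cos0 subrr !mulr0.
by rewrite /second_difference !z !addr0 indicE mem_set// !mulr1.
Qed.

Lemma eq_weighted_integral h F : bounded_measurable F ->
    \int[nu]_x (F x * (2 * (1 - cos (dotp h (x : 'cV[R]_d))))) =
    \int[nu']_x (F x * (2 * (1 - cos (dotp h (x : 'cV[R]_d))))).
Proof.
move=> bF; have := eq_second_difference h bF.
by rewrite /second_difference eq_quadf => /addrI.
Qed.

End identification.

(** Write t = s u with u a unit vector. Positive variance gives the value through the remainder;
    zero variance, common to both sides, makes both exponents vanish. *)
Lemma eq_log_exponent {R : realType} {d : nat} (A A' : 'M[R]_d)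
    (nu nu' : {measure set (borelRd R d) -> \bar R})
    (rho rho' : 'cV[R]_d -> probability R R) :
  finite_variance nu -> finite_variance nu' -> psd A -> psd A' ->
  (forall u, enorm u = 1 -> 0 < dvariance A nu u -> remainder_law A nu u (rho u)) ->
  (forall u, enorm u = 1 -> 0 < dvariance A' nu' u -> remainder_law A' nu' u (rho' u)) ->
  (forall u, enorm u = 1 -> dvariance A nu u = dvariance A' nu' u) ->
  (forall u, enorm u = 1 -> 0 < dvariance A nu u ->
     forall S : set R, measurable S -> rho u S = rho' u S) ->
  forall theta t, log_exponent A nu theta t = log_exponent A' nu' theta t.
Proof.
move=> nu2 nu2' psdA psdA' rhoP rhoP' eV erho theta t.
have [->|t0] := eqVneq t 0.
  have z B (mu : {measure set (borelRd R d) -> \bar R}) : log_exponent B mu theta 0 = 0.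
    rewrite /log_exponent quadf0 mulr0 mul0r add0r /Rintegral integral0_eq// => x _.
    by rewrite dotp0l levy_kernel0.
  by rewrite !z.
have [s [u [u1 ->]]] := direction_decomposition t0.
have [V0|V0] := ltP 0 (dvariance A nu u).
  have V0' : 0 < dvariance A' nu' u by rewrite -eV.
  have e := remainder_integral nu2 V0 (rhoP _ u1 V0) theta s.
  have e' := remainder_integral nu2' V0' (rhoP' _ u1 V0') theta s.
  have rE : \int[rho u]_r cos (s * r + theta) = \int[rho' u]_r cos (s * r + theta).
    rewrite /Rintegral; congr fine; apply: eq_measure_integral => S mS _.
    exact: erho.
  by move: e; rewrite rE eV// e' => /(mulfI (_ : 2 != 0 :> R)) => ->.
have V00 : dvariance A nu u = 0.
  apply/eqP; rewrite eq_le V0 dvarianceE//= addr_ge0//; first exact: psdA.2.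
  by apply: Rintegral_ge0 => x _; exact: sqr_ge0.
by rewrite (log_exponent_null theta nu2 psdA V00) (log_exponent_null theta nu2' psdA') -?eV.
Qed.

(** * The drift is fixed by centering *)

Section drift.
Context {R : realType} {d : nat} {dT : measure_display} {T : measurableType dT}.
Context {P : probability T R} (X : {RV P >-> borelRd R d}).
Hypotheses (X0 : centered X) (X2 : finite_second_moment X).
Implicit Types t : 'cV[R]_d.

Lemma integrable_dotp_RV t :
  P.-integrable setT (EFin \o (fun w => dotp t (X w : 'cV[R]_d))).
Proof.
have i1 : P.-integrable setT (EFin \o (fun=> 1 : R)) by exact: finite_measure_integrable_cst.
apply: (@dominated_integrable_real _ _ _ _ _ (fun w => 1 + dotp t (X w : 'cV[R]_d) ^+ 2)).
- exact: measurable_dotp_RV.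
- move=> w; move: (dotp _ _) => a.
  by have := sqr_ge0 (a + 1); have := sqr_ge0 (a - 1); have := sqr_ge0 a;
    rewrite ler_norml => ? ? ?; apply/andP; split; lra.
- exact: (integrableD measurableT i1 (second_moment_integrable t X2)).
Qed.

Lemma centered_dotp t : \int[P]_w dotp t (X w : 'cV[R]_d) = 0.
Proof.
have iX i : P.-integrable setT (EFin \o (fun w => (X w : 'cV[R]_d) i 0)).
  have := integrable_dotp_RV (delta_mx i 0).
  by apply: eq_integrable => // w _ /=; rewrite dotp_delta.
transitivity (\int[P]_w (\sum_(i < d) t i 0 * (X w : 'cV[R]_d) i 0)).
  by apply: eq_Rintegral => w _; rewrite dotpE.
rewrite Rintegral_sum; last by move=> i; exact/integrableZ_real/iX.
rewrite big1// => i _; rewrite (RintegralZl _ measurableT (iX i)) /Rintegral.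
by have := X0 i; rewrite unlock => ->; rewrite mulr0.
Qed.

(** Centering allows <t,X> to be subtracted under the expectation of sin <t,X>, which turns a linear
    bound into a quadratic one. *)
Lemma norm_Im_charfun_le t :
  `|complex.Im (charfun X t)| <= \int[P]_w (dotp t (X w : 'cV[R]_d) ^+ 2).
Proof.
have is_ := probability_integrable (P := P) (bounded_measurable_sinX X t).
have id_ := integrable_dotp_RV t.
rewrite Im_charfun -[X in `|X|]subr0 -(centered_dotp t) -RintegralB//.
have ii := integrableB measurableT is_ id_.
apply: le_trans (le_normr_Rintegral measurableT ii) _.
apply: le_Rintegral => //.
- exact: (integrable_abse ii).
- exact: second_moment_integrable.
- by move=> w _; exact: norm_sin_sub_le.
Qed.

End drift.

Lemma cexpD_iR {R : realType} (z : R[i]) (y : R) :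
  cexp ('i%C * y%:C + z) =
  (cos y * complex.Re (cexp z) - sin y * complex.Im (cexp z)) +i*
  (cos y * complex.Im (cexp z) + sin y * complex.Re (cexp z)).
Proof.
case: z => a b; have -> : 'i%C * y%:C + (a +i* b) = a +i* (y + b) by simpc.
rewrite /cexp /=; simpc; rewrite cosD sinD.
by congr (_ +i* _); ring.
Qed.

(** The hypothesis on the characteristic functions is phi(t) = e^(i<c,t>) phi'(t), split into real
    and imaginary parts. *)
Lemma eq_drift {R : realType} {d : nat}
    (dT dT' : measure_display) (T : measurableType dT) (T' : measurableType dT')
    (P : probability T R) (P' : probability T' R)
    (X : {RV P >-> borelRd R d}) (X' : {RV P' >-> borelRd R d}) (c : 'cV[R]_d) :
  centered X -> finite_second_moment X -> centered X' -> finite_second_moment X' ->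
  (forall t, charfun X t =
    (cos (dotp c t) * complex.Re (charfun X' t) - sin (dotp c t) * complex.Im (charfun X' t))
      +i*
    (cos (dotp c t) * complex.Im (charfun X' t) +
      sin (dotp c t) * complex.Re (charfun X' t))) ->
  c = 0.
Proof.
move=> X0 X2 X0' X2' eX.
(* With t = s c and s -> 0, both Im phi(t) and Im phi'(t) are O(s^2), whereas a
   nonzero c would contribute the term sin (s |c|^2), linear in s. *)
apply: contrapT => /eqP/enorm_gt0 c0.
have k0 : 0 < dotp c c by rewrite -sqr_enorm exprn_gt0.
set k := dotp c c in k0.
pose M := \int[P]_w (dotp c (X w : 'cV[R]_d) ^+ 2).
pose M' := \int[P']_w (dotp c (X' w : 'cV[R]_d) ^+ 2).
have M0 : 0 <= M by apply: Rintegral_ge0 => w _; exact: sqr_ge0.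
have M0' : 0 <= M' by apply: Rintegral_ge0 => w _; exact: sqr_ge0.
pose D := 8 * (M + M' + 1) + 2 * k ^+ 2.
have k2 : 0 < k ^+ 2 by rewrite exprn_gt0.
have D0 : 0 < D by rewrite /D; lra.
pose s := k / D.
have s0 : 0 < s by rewrite divr_gt0.
have sD : s * D = k by rewrite /s divfK// gt_eqF.
have sk : s * k <= 2^-1.
  by rewrite /s mulrAC ler_pdivrMr// -expr2 /D; lra.
have sM : 8 * (s * (M + M' + 1)) + 2 * (s * k ^+ 2) = k by rewrite -[RHS]sD /D; ring.
have sk2 : 0 <= s * k ^+ 2 by rewrite mulr_ge0// ltW.
have sM1 : s * (M + M') <= k / 8 by have := s0; lra.
have sM0 : 0 <= s * M by rewrite mulr_ge0// ltW.
have s2M : s * (s * (M + M')) <= 1 / 16.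
  apply: le_trans (_ : s * (k / 8) <= _); first by rewrite ler_pM2l.
  by lra.
have s2M0 : 0 <= s * (s * M) by rewrite mulr_ge0// ltW.
have Mscale (dU : measure_display) (U : measurableType dU) (PU : probability U R) (Z : {RV PU
  >-> borelRd R d}) :
    finite_second_moment Z ->
    \int[PU]_w (dotp (s *: c) (Z w : 'cV[R]_d) ^+ 2) =
      s * (s * \int[PU]_w (dotp c (Z w : 'cV[R]_d) ^+ 2)).
  move=> Z2; rewrite mulrA -expr2 -(RintegralZl _ measurableT (second_moment_integrable c Z2)).
  by apply: eq_Rintegral => w _; rewrite dotpZl exprMn.
have h1 := norm_Im_charfun_le X0 X2 (s *: c).
have h2 := norm_Im_charfun_le X0' X2' (s *: c).
have h3 := Re_charfun_ge (s *: c) X2'.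
rewrite !Mscale// -/M in h1; rewrite !Mscale// -/M' in h2; rewrite !Mscale// -/M' in h3.
have cs : dotp c (s *: c) = s * k by rewrite /dotp -scalemxAr mxE.
have eIm : complex.Im (charfun X (s *: c)) = cos (s * k) * complex.Im (charfun X' (s *: c)) +
    sin (s * k) * complex.Re (charfun X' (s *: c)) by rewrite eX cs.
move: h1; rewrite eIm.
have sk0 : 0 <= s * k by rewrite mulr_ge0// ltW.
have h4 := sin_ge_half sk0 sk.
move: (complex.Im _) (complex.Re _) h2 h3 => q r h2 h3.
have h5 : `|cos (s * k) * q| <= s * (s * M').
  rewrite normrM; apply: le_trans h2; rewrite ler_piMl//.
  by rewrite ler_norml cos_geN1 cos_le1.
move=> h1.
have h6 : sin (s * k) * r <= s * (s * M) + s * (s * M').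
  by move: h1 h5; rewrite !ler_norml => /andP[_ ?] /andP[? _]; lra.
have r2 : 2^-1 <= r by move: h3; lra.
have h7 : s * k / 2 * 2^-1 <= sin (s * k) * r.
  by apply: ler_pM => //; apply: divr_ge0.
(* By [h7] and [h6], s k / 4 <= sin (s k) r <= s^2 (M + M') <= s k / 8, impossible for s, k > 0. *)
have : s * k <= s * (k / 2).
  have : s * (s * (M + M')) <= s * (k / 8) by rewrite ler_pM2l.
  by lra.
by rewrite ler_pM2l//; lra.
Qed.

(** * The characteristic function determines the law *)

Lemma eq_charfun_same_law {R : realType} {d : nat}
    (dT dT' : measure_display) (T : measurableType dT) (T' : measurableType dT')
    (P : probability T R) (P' : probability T' R)
    (X : {RV P >-> borelRd R d}) (X' : {RV P' >-> borelRd R d}) :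
  (forall t, charfun X t = charfun X' t) -> same_law X X'.
Proof.
move=> eX S mS.
have mX : measurable_fun setT X by exact: measurable_funP.
have mX' : measurable_fun setT X' by exact: measurable_funP.
have bL := expectation_functional P (0 : borelRd R d) mX.
have bL' := expectation_functional P' (0 : borelRd R d) mX'.
(* The expectation of a wave is a combination of the real and imaginary parts of the characteristic
   function, so the two expectations agree on waves. *)
have := eq_functional_waves bL bL' _ (bounded_measurable_indic mS).
rewrite (integral_indic_preimage P mX mS) (integral_indic_preimage P' mX' mS) => e.
have {}e : fine (P (X @^-1` S)) = fine (P' (X' @^-1` S)).
  by apply: e => t theta; rewrite !integral_wave eX.
have mXS : measurable (X @^-1` S) by rewrite -[X in measurable X]setTI; exact: mX.
have mXS' : measurable (X' @^-1` S) by rewrite -[X in measurable X]setTI; exact: mX'.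
have fX := fin_num_measure P _ mXS.
have fX' := fin_num_measure P' _ mXS'.
have : P (X @^-1` S) = P' (X' @^-1` S) by rewrite -(fineK fX) -(fineK fX') e.
by [].
Qed.

(** * Assembly: equality of the triplets, then of the laws *)

Unset Implicit Arguments.

Theorem proposition3p2 (R : realType) (d : nat)
  (dT dT' : measure_display) (T : measurableType dT) (T' : measurableType dT')
  (P : probability T R) (P' : probability T' R)
  (X : {RV P >-> borelRd R d}) (X' : {RV P' >-> borelRd R d})
  (b b' : 'cV[R]_d) (A A' : 'M[R]_d)
  (nu nu' : {measure set (borelRd R d) -> \bar R})
  (X_id : infinitely_divisible X) (X'_id : infinitely_divisible X')
  (X_centered : centered X) (X'_centered : centered X')
  (X_L2 : finite_second_moment X) (X'_L2 : finite_second_moment X')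
  (X_triplet : levy_triplet X b A nu) (X'_triplet : levy_triplet X' b' A' nu')
  (rho rho' : 'cV[R]_d -> probability R R)
  (rho_law : forall u, enorm u = 1 -> 0 < dvariance A nu u ->
     remainder_law A nu u (rho u))
  (rho'_law : forall u, enorm u = 1 -> 0 < dvariance A' nu' u ->
     remainder_law A' nu' u (rho' u))
  (eq_variance : forall u, enorm u = 1 -> dvariance A nu u = dvariance A' nu' u)
  (eq_remainder : forall u, enorm u = 1 -> 0 < dvariance A nu u ->
     forall S : set R, measurable S -> rho u S = rho' u S) :
  same_law X X' /\
  [/\ b = b', A = A' &
      forall S : set (borelRd R d), measurable S -> nu S = nu' S].
Proof.
have [psdA lnu phi] := X_triplet; have [psdA' lnu' phi'] := X'_triplet.
have nu2 : finite_variance nu by move=> t; exact: (levy_second_moment X_L2 X_triplet).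
have nu2' : finite_variance nu' by move=> t; exact: (levy_second_moment X'_L2 X'_triplet).
have eE := eq_log_exponent nu2 nu2' psdA psdA' rho_law rho'_law eq_variance eq_remainder.
have eA : A = A'.
  by apply: (eq_quadf_mx psdA.1 psdA'.1) => h; exact: (eq_quadf nu2 nu2' eE).
have enu : forall S : set (borelRd R d), measurable S -> nu S = nu' S.
  apply: (eq_levy_measure nu2 nu2' lnu lnu') => h F bF.
  exact: (eq_weighted_integral nu2 nu2' eE).
have ecint (f : borelRd R d -> R[i]) : cintegral nu f = cintegral nu' f.
  rewrite /cintegral /Rintegral.
  by congr (fine _ +i* fine _); apply: eq_measure_integral => S mS _; exact: enu.
(* Once A and nu are identified, the truncated integrals coincide and only the drifts can differ. *)
have eexp t : levy_exponent b A nu t = 'i%C * (dotp (b - b') t)%:C + levy_exponent b' A' nu' t.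
  rewrite /levy_exponent ecint eA dotpDl dotpNl rmorphB /= mulrBr.
  by rewrite !addrA subrK.
have ephi t : charfun X t =
    (cos (dotp (b - b') t) * complex.Re (charfun X' t) - sin (dotp (b - b') t) * complex.Im
      (charfun X' t)) +i*
    (cos (dotp (b - b') t) * complex.Im (charfun X' t) +
      sin (dotp (b - b') t) * complex.Re (charfun X' t)).
  by rewrite phi phi' eexp cexpD_iR.
have eb : b = b'.
  by apply/eqP; rewrite -subr_eq0; apply/eqP;
    exact: (eq_drift X_centered X_L2 X'_centered X'_L2 ephi).
split=> //.
apply: eq_charfun_same_law => t.
by rewrite phi phi' eexp eb subrr dotp0l mulr0 add0r.
Qed.
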